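(* Let $\mathcal{P}$ be the set of primes $p$ such that $p \ge 7$ and neither $4$ nor $32$ lies in the subgroup of $\mathbb{Z}_p^*$ generated by $\{-1, 6\}$. Then $\mathcal{P}$ is infinite, and for every $p \in \mathcal{P}$, $\mathrm{OP}(F)$ has a solution (i.e. $K_p$ has a factorisation into $F$) for every 2-regular graph $F$ of order $p$ satisfying $\nu_3(F) \le \nu_5(F) + \sum_{i=7}^{p} \nu_i(F)$, where $\nu_m(F)$ denotes the number of $m$-cycles in $F$.
   Context: $\mathbb{Z}_p^*$ is the multiplicative group of units modulo $p$. A factor of a graph is a spanning subgraph; a factorisation is a decomposition of the edge set into edge-disjoint factors; a factorisation into $F$ is one in which every factor is isomorphic to $F$. For a 2-regular graph $F$ of odd order $n$, $\mathrm{OP}(F)$ asks for a factorisation of $K_n$ into $F$. *)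

(* Defs.v *)
From HB Require Import structures.
From mathcomp Require Import all_boot all_order all_algebra all_fingroup.
From mathcomp Require Import classical_sets cardinality.

Set Implicit Arguments.
Unset Strict Implicit.
Unset Printing Implicit Defensive.

Import GRing.Theory.

Local Open Scope nat_scope.

Record sgraph (V : finType) := SGraph {
  adj :> rel V;
  adj_sym : symmetric adj;
  adj_irr : irreflexive adj
}.

Lemma complete_sym (V : finType) : symmetric (fun x y : V => x != y).
Proof. by move=> x y; rewrite eq_sym. Qed.

Lemma complete_irr (V : finType) : irreflexive (fun x y : V => x != y).
Proof. by move=> x; rewrite eqxx. Qed.

Definition complete_graph (V : finType) : sgraph V :=
  SGraph (@complete_sym V) (@complete_irr V).

Definition regular (V : finType) (G : sgraph V) (k : nat) : Prop :=
  forall x : V, #|[pred y | G x y]| = k.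

Definition isomorphic (V W : finType) (G : sgraph V) (H : sgraph W) : Prop :=
  exists f : V -> W, bijective f /\ forall x y : V, H (f x) (f y) = G x y.

(* A factor shares its vertex type with the graph, so it is spanning. *)
Definition is_factor (V : finType) (G H : sgraph V) : Prop :=
  forall x y : V, H x y -> G x y.

Definition is_factorisation (V : finType) (G : sgraph V) (k : nat)
    (H : 'I_k -> sgraph V) : Prop :=
  [/\ forall i, is_factor G (H i),
      forall i j, i != j -> forall x y, ~~ (H i x y && H j x y)
    & forall x y, G x y -> exists i, H i x y].

Definition has_factorisation_into (V W : finType)
    (G : sgraph V) (F : sgraph W) : Prop :=
  exists k (H : 'I_k -> sgraph V),
    is_factorisation G H /\ forall i, isomorphic (H i) F.

Definition OP_solvable (V : finType) (F : sgraph V) : Prop :=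
  has_factorisation_into (complete_graph 'I_#|V|) F.

Definition cycle_edges (V : finType) (c : seq V) : {set {set V}} :=
  [set [set x; next c x] | x in c]%SET.

(* The m-cycles of F are counted as subgraphs, each given by its edge set, so
   the choice of starting vertex and direction does not matter. The guard
   [2 < m] is needed because [ucycleb] accepts the sequence x, y for an edge. *)
Definition num_cycles (V : finType) (F : sgraph V) (m : nat) : nat :=
  #|[set cycle_edges c | c : m.-tuple V & (2 < m) && ucycleb F c]%SET|.

Definition gens_N1_6 (p : nat) : {set {unit 'F_p}} :=
  [set u : {unit 'F_p} | (val u == -1)%R || (val u == 6%:R)%R]%SET.

(* For a prime p >= 7 the residues -1, 4, 6 and 32 are all units, so passing
   through their images in 'F_p loses nothing. *)
Definition in_gen_N1_6 (p : nat) (x : 'F_p) : bool :=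
  x \in [set val u | u in <<gens_N1_6 p>>%g]%SET.

Definition OP_primes : set nat := fun p =>
  [/\ prime p, 7 <= p, ~~ @in_gen_N1_6 p 4%:R%R
    & ~~ @in_gen_N1_6 p 32%:R%R].

(* Main.v *)
(* Let H be the subgroup of the units generated by -1 and 6. In the quotient by H
   we have 3 = 1/2, so a multiple g{1, 2, 3} covers three, and g{1, 2, 3, 4} four,
   consecutive powers of 2. The hypothesis says that the order of 2 in the quotient
   is not 1, 2 or 5, i.e. is of the form 3a + 4b; hence K_p decomposes into
   circulant graphs with connection set {1, 2, 3} or {1, 2, 3, 4}. These are cut
   into strips, each carrying, in every colour, one or a few whole cycles of F;
   strips for long cycles come from periodic families.

   For infinitude, take w, c in a field with w^2 + w + 1 = 0, 2 c^3 = 1 + 2 w and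
   2 (- M (1 + c))^3 = w. Then 6 = (- 2 c^2)^3 is a cube, and 2 is a cube times w,
   hence is not a cube in F_p if p is not 1 mod 9. Eliminating c and w gives an
   integer N(M) such that such w and c exist in F_p for all prime divisors p of
   N(M); as N(M) is 7 mod 9, some p is not 1 mod 9. *)

Require Import Defs.
From HB Require Import structures.
From mathcomp Require Import all_boot all_order all_algebra all_fingroup.
From mathcomp Require Import cyclic finfield.
From mathcomp Require Import zify ring.

Set Implicit Arguments.
Unset Strict Implicit.
Unset Printing Implicit Defensive.

Local Open Scope nat_scope.

(** The strips are cut from an infinite circulant graph on the naturals. A block finds a fixed set
    of vertices and edges used at its left end and leaves the translate of that set used at its
    right end. So blocks with a common boundary can be joined in any order, and a row of total
    length p closes up modulo p, where the two ends coincide. Every colour of a block has the same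
    cycle lengths, so all factors have the shape of F. The inequality on F enters in one place: each
    triangle shares a block with a 5-cycle or with a cycle of length at least 7. The delicate
    connection set is {1, 2, 3, 4}, where 4-cycles need company; that p is odd and not 9 removes the
    lists out of reach. For infinitude the prime divisors of N(M) must also be large. As 3^6 N(M) is
    1 modulo M^3, no prime divisor of M other than 3 divides N(M). So M is the square of the product
    of all small primes except 3; being a square it is 1 mod 3, which puts N(M) in the class 7 mod
    9. *)

(** * Consecutive pairs along paths and cycles *)

Definition path_pairs (T : Type) (s : seq T) : seq (T * T) := zip s (behead s).

Definition cycle_pairs (T : Type) (s : seq T) : seq (T * T) := zip s (rot 1 s).

Lemma path_pairs_cat (T : Type) (s t : seq T) x y :
  path_pairs (rcons s x ++ y :: t) =
  path_pairs (rcons s x) ++ (x, y) :: path_pairs (y :: t).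
Proof.
case: s => [|z s] //=; elim: s z => [|w s IH] z //=.
by have := IH w; rewrite /path_pairs /= => ->.
Qed.

(** The ends of [w] are repeated in the outer parts, so a path growing at both ends keeps its old
    pairs and only gains new ones. [x] is just a default value for [head] and [last]. *)
Lemma path_pairs_extend (T : Type) (p w q : seq T) x :
  0 < size w ->
  path_pairs (p ++ w ++ q) =
  path_pairs (rcons p (head x w)) ++ path_pairs w ++ path_pairs (last x w :: q).
Proof.
case: w => // y w _ /=.
have pq z : path_pairs (rcons p z) ++ path_pairs (z :: w ++ q) =
    path_pairs (p ++ z :: w ++ q).
  case/lastP: p => [|p u] //; rewrite path_pairs_cat -{1}cats1 path_pairs_cat.
  by rewrite -catA.
rewrite -pq; congr (_ ++ _).
case: q pq => [|u q] _; first by rewrite !cats0.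
by rewrite (lastI y w) -cat_cons (lastI y w) path_pairs_cat.
Qed.

Lemma cycle_pairs_closed (T : Type) (w q : seq T) x :
  0 < size w ->
  cycle_pairs (w ++ q) =
  path_pairs w ++ path_pairs (last x w :: rcons q (head x w)).
Proof.
case: w => // y w _.
have -> : cycle_pairs ((y :: w) ++ q) = path_pairs ((y :: w) ++ rcons q y).
  rewrite /cycle_pairs /path_pairs /= rot1_cons -rcons_cat.
  set s := w ++ q; rewrite -(cats1 s y) -cat_cons.
  have zs (u v : seq T) z : size u = size v -> zip (u ++ z) v = zip u v.
    by elim: u v => [|a u IH] [|b v] //=; [case: z | case=> /IH ->].
  by rewrite zs //= size_cat addn1.
have := @path_pairs_extend _ [::] (y :: w) (rcons q y) y isT.
by rewrite /= => ->.
Qed.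

Lemma zip_map_pair (T T' : Type) (f : T -> T') s t :
  zip (map f s) (map f t) = map (fun e => (f e.1, f e.2)) (zip s t).
Proof. by elim: s t => [|x s IH] [|y t] //=; rewrite IH. Qed.

Lemma map_path_pairs (T T' : Type) (f : T -> T') s :
  path_pairs (map f s) = map (fun e => (f e.1, f e.2)) (path_pairs s).
Proof. by rewrite /path_pairs behead_map zip_map_pair. Qed.

Lemma map_cycle_pairs (T T' : Type) (f : T -> T') s :
  cycle_pairs (map f s) = map (fun e => (f e.1, f e.2)) (cycle_pairs s).
Proof. by rewrite /cycle_pairs -map_rot zip_map_pair. Qed.

(** * Cutting a circulant graph into strips *)

(* The edge {x, y} of the infinite circulant graph on the naturals is recorded
   as its lower end together with its length. *)
Definition edge_of (e : nat * nat) : nat * nat :=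
  (minn e.1 e.2, maxn e.1 e.2 - minn e.1 e.2).

Definition path_edges (s : seq nat) := map edge_of (path_pairs s).

Definition cycle_edge_seq (s : seq nat) := map edge_of (cycle_pairs s).

Definition edges_of (P : seq (seq nat)) := flatten (map cycle_edge_seq P).

Definition eshift n (E : seq (nat * nat)) := [seq (n + e.1, e.2) | e <- E].

Definition shift_cycles n (P : seq (seq nat)) := map (map (addn n)) P.

Definition strip (S : seq nat) n := [seq (i, d) | i <- iota 0 n, d <- S].

Lemma edge_of_shift n e : edge_of (n + e.1, n + e.2) = (n + (edge_of e).1, (edge_of e).2).
Proof. by rewrite /edge_of /= -addn_minr -addn_maxr subnDl. Qed.

Lemma path_edges_shift n s : path_edges (map (addn n) s) = eshift n (path_edges s).
Proof.
by rewrite /path_edges map_path_pairs /eshift -!map_comp; apply: eq_map => e /=;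
  rewrite edge_of_shift.
Qed.

Lemma edges_of_shift n P : edges_of (shift_cycles n P) = eshift n (edges_of P).
Proof.
rewrite /edges_of /eshift map_flatten -!map_comp; congr flatten; apply: eq_map => s /=.
rewrite /cycle_edge_seq map_cycle_pairs -!map_comp; apply: eq_map => e /=.
by rewrite edge_of_shift.
Qed.

Lemma edges_of_cat P Q : edges_of (P ++ Q) = edges_of P ++ edges_of Q.
Proof. by rewrite /edges_of map_cat flatten_cat. Qed.

Lemma edges_of1 s : edges_of [:: s] = cycle_edge_seq s.
Proof. exact: cats0. Qed.

Lemma strip_add S m n : strip S (m + n) = strip S m ++ eshift m (strip S n).
Proof.
rewrite /strip iotaD map_cat flatten_cat add0n; congr (_ ++ _).
rewrite /eshift map_flatten -map_comp -{1}[m]addn0 iotaDl -map_comp.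
by congr flatten; apply: eq_map => i /=; rewrite -map_comp.
Qed.

(* [permP] at two types for which [lia] must see syntactically equal counts. *)
Lemma perm_natP (s t : seq nat) :
  reflect (forall a : pred nat, count a s = count a t) (perm_eq s t).
Proof. exact: seq.permP. Qed.

Lemma perm_edgeP (s t : seq (nat * nat)) :
  reflect (forall a : pred (nat * nat), count a s = count a t) (perm_eq s t).
Proof. exact: seq.permP. Qed.

Lemma count_shift (a : pred nat) n s :
  count a (map (addn n) s) = count (fun i => a (n + i)) s.
Proof. by rewrite count_map. Qed.

Lemma iota_shift m n : iota m n = map (addn m) (iota 0 n).
Proof. by rewrite -iotaDl addn0. Qed.

Lemma count_eshift a n E : count a (eshift n E) = count (fun e => a (n + e.1, e.2)) E.
Proof. by rewrite count_map. Qed.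

Lemma count_flatten_cat (I T : Type) (a : pred T) (f g : I -> seq T) s :
  count a (flatten [seq f i ++ g i | i <- s]) =
  count a (flatten [seq f i | i <- s]) + count a (flatten [seq g i | i <- s]).
Proof. by elim: s => //= i s IH; rewrite !count_cat IH; lia. Qed.

Lemma count_flatten_eq (I : eqType) (T : Type) (a : pred T) (f g : I -> seq T) s :
  {in s, forall i, count a (f i) = count a (g i)} ->
  count a (flatten [seq f i | i <- s]) = count a (flatten [seq g i | i <- s]).
Proof.
elim: s => //= i s IH h; rewrite !count_cat h ?mem_head // IH // => j js.
by rewrite h // inE js orbT.
Qed.

(** * Blocks with matching ends, and paths running through many strips *)

Section Blocks.

(* [K] colours; at the left end of a block the edges in [D] and, in colour c,
   the vertices in [B c] have already been used. *)
Variables (K : nat) (S : seq nat) (D : seq (nat * nat)) (B : nat -> seq nat).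

Definition is_block (P : nat -> seq (seq nat)) n (L : seq nat) :=
  [&& all (fun c => perm_eq (flatten (P c) ++ B c)
                      (iota 0 n ++ map (addn n) (B c))) (iota 0 K),
      perm_eq (flatten [seq edges_of (P c) | c <- iota 0 K] ++ D)
        (strip S n ++ eshift n D)
    & all (fun c => perm_eq (map size (P c)) L) (iota 0 K)].

Definition has_block L := exists P, is_block P (sumn L) L.

Lemma has_block_nil : has_block [::].
Proof.
exists (fun=> [::]); apply/and3P; split.
- by apply/allP => c _ /=; rewrite (@eq_map _ _ _ id) ?map_id.
- rewrite /eshift (@eq_map _ _ _ id) ?map_id //; last by case.
  by elim: (iota 0 K) => //=.
- by apply/allP.
Qed.

Lemma has_block_perm L L' : perm_eq L L' -> has_block L -> has_block L'.
Proof.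
move=> pL [P /and3P[h1 h2 /allP h3]]; exists P; rewrite -(perm_sumn pL).
apply/and3P; split=> //; apply/allP => c cK.
exact: perm_trans (h3 c cK) pL.
Qed.

(** The boundary left behind by the first block is the left boundary of the second one translated by
    [m]. It stands on opposite sides of the two multiset equations and cancels when their counts are
    added. *)
Lemma has_block_cat L L' : has_block L -> has_block L' -> has_block (L ++ L').
Proof.
move=> [P /and3P[/allP p1 p2 /allP p3]] [Q /and3P[/allP q1 q2 /allP q3]].
rewrite /has_block sumn_cat; set m := sumn L; set n := sumn L' in q1 q2 q3 *.
exists (fun c => P c ++ shift_cycles m (Q c)).
apply/and3P; split.
- apply/allP => c cK; apply/perm_natP => a.
  move/perm_natP/(_ a): (p1 c cK); move/perm_natP/(_ (fun i => a (m + i))): (q1 c cK).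
  rewrite iotaD flatten_cat add0n (iota_shift m) /shift_cycles -map_flatten.
  rewrite !count_cat !count_shift.
  have -> : count (fun i => a (m + n + i)) (B c) = count (fun i => a (m + (n + i))) (B c).
    by apply: eq_count => x /=; rewrite addnA.
  rewrite -/m; lia.
- apply/perm_edgeP => a.
  move/perm_edgeP/(_ a): p2; move/perm_edgeP/(_ (fun e => a (m + e.1, e.2))): q2.
  rewrite strip_add !count_cat !count_eshift.
  under [X in _ -> _ -> count a (flatten X) + _ = _]eq_map => c.
    rewrite edges_of_cat edges_of_shift. over.
  rewrite count_flatten_cat.
  have -> : count a (flatten [seq eshift m (edges_of (Q c)) | c <- iota 0 K]) =
            count (fun e => a (m + e.1, e.2)) (flatten [seq edges_of (Q c) | c <- iota 0 K]).
    by rewrite -count_eshift /eshift map_flatten -map_comp.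
  have -> : count (fun e => a (m + n + e.1, e.2)) D =
            count (fun e => a (m + (n + e.1), e.2)) D.
    by apply: eq_count => e; rewrite addnA.
  rewrite -/m /=; lia.
- apply/allP => c cK; rewrite map_cat; apply: perm_cat; first exact: p3.
  rewrite /shift_cycles -map_comp (eq_map (g := size)) => [|s /=]; first exact: q3.
  by rewrite size_map.
Qed.

(* An open block carries in every colour c one further path [W c], ending at the
   vertices [u c] and [v c] of the right boundary; it uses all edges whose lower
   end is below the boundary, and the vertices [BO c] beyond it. *)
Variables (BO : nat -> seq nat) (u v : nat -> nat).

Definition is_open (P : nat -> seq (seq nat)) (W : nat -> seq nat) n :=
  all (fun c => [&& perm_eq (flatten (P c) ++ W c ++ B c)
                      (iota 0 n ++ map (addn n) (BO c)),
                    0 < size (W c), head 0 (W c) == n + u c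
                  & last 0 (W c) == n + v c]) (iota 0 K)
  && perm_eq (flatten [seq edges_of (P c) ++ path_edges (W c) | c <- iota 0 K] ++ D)
       (strip S n).

(** The path of colour c is prolonged by [p c] at its head and by [q c] at its end. The open
    boundary reappears translated by [t], so the step can be iterated. *)
Definition is_extension (p q : nat -> seq nat) t :=
  all (fun c => [&& perm_eq (p c ++ q c ++ BO c)
                      (iota 0 t ++ map (addn t) (BO c)),
                    head 0 (rcons (p c) (u c)) == t + u c
                  & last 0 (v c :: q c) == t + v c]) (iota 0 K)
  && perm_eq (flatten [seq path_edges (rcons (p c) (u c)) ++ path_edges (v c :: q c)
                         | c <- iota 0 K]) (strip S t).

(** [R c] joins the two ends of the open path into a cycle, [Q c] holds further whole cycles, and
    the boundary returns from [BO] to the pair [B], [D] of ordinary blocks. *)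
Definition is_closure (R : nat -> seq nat) (Q : nat -> seq (seq nat)) r :=
  all (fun c => perm_eq (R c ++ flatten (Q c) ++ BO c)
                  (iota 0 r ++ map (addn r) (B c))) (iota 0 K)
  && perm_eq (flatten [seq path_edges (v c :: rcons (R c) (u c)) ++ edges_of (Q c)
                         | c <- iota 0 K]) (strip S r ++ eshift r D).

Lemma flatten_eshift (I : Type) n (f : I -> seq (nat * nat)) s :
  flatten [seq eshift n (f i) | i <- s] = eshift n (flatten [seq f i | i <- s]).
Proof. by rewrite /eshift map_flatten -map_comp. Qed.

Lemma open_extend P W n p q t : is_open P W n -> is_extension p q t ->
  is_open P (fun c => map (addn n) (p c) ++ W c ++ map (addn n) (q c)) (n + t).
Proof.
move=> /andP[/allP oV oE] /andP[/allP eV eE].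
have hW c : c \in iota 0 K ->
  [/\ 0 < size (W c), head 0 (W c) = n + u c & last 0 (W c) = n + v c].
  by move=> /oV/and4P[_ ? /eqP ? /eqP ?].
apply/andP; split.
  apply/allP => c cK; have [W0 hd ls] := hW c cK.
  case/and4P: (oV c cK) => oP _ _ _; case/and3P: (eV c cK) => eP /eqP ehd /eqP els.
  apply/and4P; split.
  - apply/perm_natP => a.
    move/perm_natP/(_ a): oP; move/perm_natP/(_ (fun i => a (n + i))): eP.
    rewrite iotaD add0n (iota_shift n) !count_cat !count_shift.
    have -> : count (fun i => a (n + t + i)) (BO c) =
              count (fun i => a (n + (t + i))) (BO c).
      by apply: eq_count => x /=; rewrite addnA.
    lia.
  - by rewrite !size_cat; lia.
  (* An empty [p c] forces [t = 0], so the old head of [W c] is still in the right place. *)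
  - case: (p c) ehd => [/= /eqP|x s /= ->]; last by rewrite addnA.
    by rewrite eqn_leq => /andP[? ?]; case: (W c) W0 hd => //= x s _ ->; apply/eqP; lia.
  - rewrite !last_cat; case/lastP: (q c) els => [/= els|s x].
      by case: (W c) W0 ls => //= x s _ ->; apply/eqP; lia.
    by rewrite /= last_rcons map_rcons last_rcons => ->; rewrite addnA.
apply/perm_edgeP => a.
move/perm_edgeP/(_ a): oE; move/perm_edgeP/(_ (fun e => a (n + e.1, e.2))): eE.
rewrite strip_add !count_cat -!count_eshift.
suff E : count a (flatten [seq edges_of (P c) ++
              path_edges (map (addn n) (p c) ++ W c ++ map (addn n) (q c)) | c <- iota 0 K]) =
    count a (eshift n (flatten [seq path_edges (rcons (p c) (u c)) ++
                                    path_edges (v c :: q c) | c <- iota 0 K])) +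
    count a (flatten [seq edges_of (P c) ++ path_edges (W c) | c <- iota 0 K]).
  by rewrite E; lia.
rewrite -flatten_eshift -count_flatten_cat; apply: count_flatten_eq => c cK.
have [W0 hd ls] := hW c cK.
rewrite /path_edges (path_pairs_extend _ _ 0 W0) hd ls -map_rcons.
rewrite -(map_cons (addn n) (v c)) !map_cat -!/(path_edges _) !path_edges_shift.
by rewrite /eshift map_cat !count_cat; lia.
Qed.

Lemma closure_block P W n R Q r L : is_open P W n -> is_closure R Q r ->
  all (fun c => perm_eq (map size (P c) ++ map size (Q c)) L) (iota 0 K) ->
  0 < K -> sumn L <= n + r ->
  has_block (L ++ [:: n + r - sumn L]).
Proof.
move=> /andP[/allP oV oE] /andP[/allP eV eE] /allP shP K0 Ln.
have hW c : c \in iota 0 K ->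
  [/\ 0 < size (W c), head 0 (W c) = n + u c & last 0 (W c) = n + v c].
  by move=> /oV/and4P[_ ? /eqP ? /eqP ?].
rewrite /has_block sumn_cat /= addn0 subnKC //.
exists (fun c => P c ++ shift_cycles n (Q c) ++ [:: W c ++ map (addn n) (R c)]).
apply/and3P; split.
- apply/allP => c cK; have [W0 hd ls] := hW c cK.
  case/and4P: (oV c cK) => oP _ _ _; have eP := eV c cK.
  apply/perm_natP => a.
  move/perm_natP/(_ a): oP; move/perm_natP/(_ (fun i => a (n + i))): eP.
  rewrite iotaD add0n (iota_shift n) !flatten_cat /shift_cycles -map_flatten /= cats0.
  rewrite !count_cat !count_shift.
  have -> : count (fun i => a (n + r + i)) (B c) = count (fun i => a (n + (r + i))) (B c).
    by apply: eq_count => x /=; rewrite addnA.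
  lia.
- apply/perm_edgeP => a.
  move/perm_edgeP/(_ a): oE; move/perm_edgeP/(_ (fun e => a (n + e.1, e.2))): eE.
  rewrite strip_add !count_cat -!count_eshift.
  have -> : eshift (n + r) D = eshift n (eshift r D).
    by rewrite /eshift -map_comp; apply: eq_map => e /=; rewrite addnA.
  suff E : count a (flatten [seq edges_of (P c ++ shift_cycles n (Q c) ++
                                 [:: W c ++ map (addn n) (R c)]) | c <- iota 0 K]) =
      count a (eshift n (flatten [seq path_edges (v c :: rcons (R c) (u c)) ++
                                      edges_of (Q c) | c <- iota 0 K])) +
      count a (flatten [seq edges_of (P c) ++ path_edges (W c) | c <- iota 0 K]).
    by rewrite E; lia.
  rewrite -flatten_eshift -count_flatten_cat; apply: count_flatten_eq => c cK.
  have [W0 hd ls] := hW c cK.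
  rewrite !edges_of_cat edges_of_shift edges_of1.
  rewrite /cycle_edge_seq (cycle_pairs_closed _ 0 W0) hd ls -map_rcons.
  rewrite -(map_cons (addn n) (v c)) !map_cat -!/(path_edges _) !path_edges_shift.
  by rewrite /eshift map_cat !count_cat; lia.
- apply/allP => c cK; rewrite !map_cat catA; apply: perm_cat.
    rewrite /shift_cycles -map_comp (eq_map (f := size \o _) (g := size)) ?shP // => s /=.
    by rewrite size_map.
  (* The length of the closed path is forced by counting vertices: the sizes of [B c] and [BO c]
     cancel between the open block and the closure. *)
  have h : n + r - sumn L = size (W c ++ map (addn n) (R c)).
    have hL : sumn (map size (P c)) + sumn (map size (Q c)) = sumn L.
      by rewrite -sumn_cat; exact: perm_sumn (shP c cK).
    have hP : sumn (map size (P c)) + (size (W c) + size (B c)) = n + size (BO c).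
      case/and4P: (oV c cK) => /perm_size + _ _ _.
      by rewrite !size_cat size_flatten size_map size_iota.
    have hQ : size (R c) + (sumn (map size (Q c)) + size (BO c)) = r + size (B c).
      by have /perm_size := eV c cK; rewrite !size_cat size_flatten size_map size_iota.
    rewrite size_cat size_map; lia.
  by rewrite h.
Qed.

End Blocks.

(** * Explicit blocks for the connection sets {1, 2, 3} and {1, 2, 3, 4} *)

Lemma block_certificate K S D B (P : seq (seq (seq nat))) L :
  is_block K S D B (nth [::] P) (sumn L) L -> has_block K S D B L.
Proof. by exists (nth [::] P). Qed.

(** One open block, one extension and one closure settle a whole residue class of lengths [l] modulo
    [t], from finitely many checks. *)
Lemma closure_family K S D B BO u v P W n p q t R Q r L m l :
  is_open K S D B BO u v P W n -> is_extension K S BO u v p q t ->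
  is_closure K S D B BO u v R Q r ->
  all (fun c => perm_eq (map size (P c) ++ map size (Q c)) L) (iota 0 K) ->
  0 < K -> sumn L <= n + r -> l = n + t * m + r - sumn L ->
  has_block K S D B (rcons L l).
Proof.
move=> op ex cl sh K0 Ln ->.
have [W' op'] : exists W', is_open K S D B BO u v P W' (n + t * m).
  elim: m => [|m [W' IH]]; first by exists W; rewrite muln0 addn0.
  by eexists; rewrite mulnS [t + _]addnC addnA; apply: open_extend IH ex.
rewrite -cats1; apply: closure_block op' cl sh K0 _; lia.
Qed.

(* The blocks below were found by computer search; the c-th entry of each list
   belongs to colour c. *)
Definition used_edges3 : seq (nat * nat) := [:: (0, 2)].
Definition used_vertices3 := nth [::] [:: [::]; [:: 0; 1]; [:: 0; 2]].
Notation has_block3 := (has_block 3 [:: 1; 2; 3] used_edges3 used_vertices3).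

Lemma block3_4 : has_block3 [:: 4].
Proof.
apply: (block_certificate
  (P := [:: [:: [:: 0; 3; 2; 1]]; [:: [:: 2; 5; 3; 4]]; [:: [:: 1; 4; 6; 3]]])).
by vm_compute.
Qed.

Lemma block3_5 : has_block3 [:: 5].
Proof.
apply: (block_certificate
  (P := [:: [:: [:: 0; 3; 4; 2; 1]]; [:: [:: 2; 5; 4; 6; 3]]; [:: [:: 1; 4; 7; 5; 3]]])).
by vm_compute.
Qed.

Lemma block3_3_5 : has_block3 [:: 3; 5].
Proof.
apply: (block_certificate
  (P := [:: [:: [:: 0; 3; 5; 2; 1]; [:: 4; 7; 6]]; [:: [:: 2; 4; 3]; [:: 5; 8; 6; 9;
      7]]; [:: [:: 1; 4; 5; 6; 3]; [:: 7; 10; 8]]])).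
by vm_compute.
Qed.

Lemma block3_3_7 : has_block3 [:: 3; 7].
Proof.
apply: (block_certificate
  (P := [:: [:: [:: 0; 3; 6; 4; 5; 2; 1]; [:: 7; 9; 8]]; [:: [:: 2; 4; 3]; [:: 5; 7;
      10; 8; 11; 9; 6]]; [:: [:: 1; 4; 7; 6; 8; 5; 3]; [:: 9; 12; 10]]])).
by vm_compute.
Qed.

Lemma block3_3_8 : has_block3 [:: 3; 8].
Proof.
apply: (block_certificate
  (P := [:: [:: [:: 0; 3; 6; 7; 4; 5; 2; 1]; [:: 8; 10; 9]]; [:: [:: 2; 4; 3]; [:: 5;
      7; 10; 12; 9; 11; 8; 6]]; [:: [:: 1; 4; 6; 9; 7; 8; 5; 3]; [:: 10; 13; 11]]])).
by vm_compute.
Qed.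

Definition open_vertices3 := nth [::] [:: [:: 0; 2]; [:: 0; 1]; [:: 0; 1]].
Definition open_start3 := nth 0 [:: 0; 0; 0].
Definition open_end3 := nth 0 [:: 2; 1; 1].

Notation is_open3 := (is_open 3 [:: 1; 2; 3] used_edges3 used_vertices3
  open_vertices3 open_start3 open_end3).
Notation is_closure3 := (is_closure 3 [:: 1; 2; 3] used_edges3 used_vertices3
  open_vertices3 open_start3 open_end3).

Lemma extension3 : is_extension 3 [:: 1; 2; 3] open_vertices3 open_start3 open_end3
  (nth [::] [:: [:: 3; 1]; [:: 3]; [:: 3; 2]])
      (nth [::] [:: [:: 5]; [:: 2; 4]; [:: 4]]) 3.
Proof. by vm_compute. Qed.

Lemma block3_long k : 6 <= k -> has_block3 [:: k].
Proof.
move=> kmin.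
have op : is_open3
    (nth [::] [:: [::]; [::]; [::]])
      (nth [::] [:: [:: 3; 0; 1; 2; 5]; [:: 3; 2; 4]; [:: 3; 1; 4]]) 3
      by vm_compute.
(* The extension has period 3, so three closures, of lengths 3, 4 and 5, cover all residues of
   [k]. *)
have -> : k = 6 + 3 * ((k - 6) %/ 3) + (k - 6) %% 3 by lia.
have := ltn_pmod (k - 6) (isT : 0 < 3).
move: (_ %/ _) (_ %% _) => m [|[|[|j]]] //= _.
- have cl : is_closure3
      (nth [::] [:: [:: 1]; [:: 4; 2; 3]; [:: 3; 5; 2]])
      (nth [::] [:: [::]; [::]; [::]]) 3
      by vm_compute.
  by apply: (closure_family (L := [::]) (m := m) op extension3 cl) => //=; lia.
- have cl : is_closure3
      (nth [::] [:: [:: 3; 1]; [:: 4; 3; 5; 2]; [:: 2; 4; 6; 3]])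
      (nth [::] [:: [::]; [::]; [::]]) 4
      by vm_compute.
  by apply: (closure_family (L := [::]) (m := m) op extension3 cl) => //=; lia.
- have cl : is_closure3
      (nth [::] [:: [:: 3; 4; 1]; [:: 2; 5; 4; 6; 3]; [:: 3; 5; 7; 4; 2]])
      (nth [::] [:: [::]; [::]; [::]]) 5
      by vm_compute.
  by apply: (closure_family (L := [::]) (m := m) op extension3 cl) => //=; lia.
Qed.

(** The triangle need not sit at the same end in all colours: here colour 0 has it in the closure,
    the other two in the open block. *)
Lemma block3_3_long k : 9 <= k -> has_block3 [:: 3; k].
Proof.
move=> kmin.
have op : is_open3
    (nth [::] [:: [::]; [:: [:: 2; 5; 3]]; [:: [:: 1; 4; 3]]])
      (nth [::] [:: [:: 6; 3; 0; 1; 2; 4; 5; 8]; [:: 6; 4; 7]; [:: 6; 5; 7]]) 6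
      by vm_compute.
have -> : k = 9 + 3 * ((k - 9) %/ 3) + (k - 9) %% 3 by lia.
have := ltn_pmod (k - 9) (isT : 0 < 3).
move: (_ %/ _) (_ %% _) => m [|[|[|j]]] //= _.
- have cl : is_closure3
      (nth [::] [:: [:: 1]; [:: 3; 6; 5; 7; 4; 2]; [:: 4; 6; 8; 5; 2; 3]])
      (nth [::] [:: [:: [:: 3; 5; 4]]; [::]; [::]]) 6
      by vm_compute.
  by apply: (closure_family (L := [:: 3]) (m := m) op extension3 cl) => //=; lia.
- have cl : is_closure3
      (nth [::] [:: [:: 3; 1]; [:: 2; 4; 7; 6; 8; 5; 3]; [:: 4; 3; 6; 9; 7; 5; 2]])
      (nth [::] [:: [:: [:: 4; 6; 5]]; [::]; [::]]) 7
      by vm_compute.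
  by apply: (closure_family (L := [:: 3]) (m := m) op extension3 cl) => //=; lia.
- have cl : is_closure3
      (nth [::] [:: [:: 3; 4; 1]; [:: 2; 4; 6; 9; 7; 8; 5; 3]; [:: 3; 6; 8; 10; 7; 4;
          5; 2]])
      (nth [::] [:: [:: [:: 5; 7; 6]]; [::]; [::]]) 8
      by vm_compute.
  by apply: (closure_family (L := [:: 3]) (m := m) op extension3 cl) => //=; lia.
Qed.

Definition used_edges4 : seq (nat * nat) := [:: (0, 1); (0, 3)].
Definition used_vertices4 := nth [::] [:: [::]; [:: 0; 1]; [:: 0; 1; 3]; [:: 0; 2]].
Notation has_block4 := (has_block 4 [:: 1; 2; 3; 4] used_edges4 used_vertices4).

Lemma block4_5 : has_block4 [:: 5].
Proof.
apply: (block_certificate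
  (P := [:: [:: [:: 0; 4; 3; 1; 2]]; [:: [:: 2; 5; 4; 6; 3]]; [:: [:: 2; 6; 5; 8; 4]];
      [:: [:: 1; 5; 3; 7; 4]]])).
by vm_compute.
Qed.

Lemma block4_6 : has_block4 [:: 6].
Proof.
apply: (block_certificate
  (P := [:: [:: [:: 0; 4; 3; 5; 1; 2]]; [:: [:: 2; 6; 4; 5; 7; 3]]; [:: [:: 2; 5; 9;
      6; 7; 4]]; [:: [:: 1; 4; 8; 5; 6; 3]]])).
by vm_compute.
Qed.

Lemma block4_3_5 : has_block4 [:: 3; 5].
Proof.
apply: (block_certificate
  (P := [:: [:: [:: 0; 4; 5; 1; 2]; [:: 3; 7; 6]]; [:: [:: 2; 5; 3]; [:: 4; 8; 6; 9;
      7]]; [:: [:: 2; 6; 4]; [:: 5; 9; 8; 11; 7]]; [:: [:: 1; 4; 3]; [:: 5; 8; 7; 10;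
      6]]])).
by vm_compute.
Qed.

Lemma block4_3_7 : has_block4 [:: 3; 7].
Proof.
apply: (block_certificate
  (P := [:: [:: [:: 0; 4; 8; 9; 5; 1; 2]; [:: 3; 7; 6]]; [:: [:: 2; 6; 4; 7; 8; 5; 3];
      [:: 9; 11; 10]]; [:: [:: 2; 5; 4]; [:: 6; 10; 13; 9; 7; 11; 8]]; [:: [:: 1; 4;
      3]; [:: 5; 7; 10; 8; 12; 9; 6]]])).
by vm_compute.
Qed.

Lemma block4_3_8 : has_block4 [:: 3; 8].
Proof.
apply: (block_certificate
  (P := [:: [:: [:: 0; 4; 8; 10; 9; 5; 1; 2]; [:: 3; 7; 6]]; [:: [:: 2; 6; 4; 7; 9; 8;
      5; 3]; [:: 10; 12; 11]]; [:: [:: 2; 5; 4]; [:: 6; 10; 14; 11; 7; 8; 12; 9]];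
      [:: [:: 1; 4; 3]; [:: 5; 7; 10; 13; 9; 11; 8; 6]]])).
by vm_compute.
Qed.

Lemma block4_3_9 : has_block4 [:: 3; 9].
Proof.
apply: (block_certificate
  (P := [:: [:: [:: 0; 4; 8; 11; 10; 9; 5; 1; 2]; [:: 3; 7; 6]]; [:: [:: 2; 6; 4; 7;
      11; 9; 8; 5; 3]; [:: 10; 13; 12]]; [:: [:: 2; 5; 4]; [:: 6; 10; 7; 8; 12; 15;
      11; 13; 9]]; [:: [:: 1; 4; 3]; [:: 5; 7; 9; 12; 11; 14; 10; 8; 6]]])).
by vm_compute.
Qed.

Lemma block4_4_4 : has_block4 [:: 4; 4].
Proof.
apply: (block_certificate
  (P := [:: [:: [:: 0; 4; 1; 2]; [:: 3; 7; 6; 5]]; [:: [:: 2; 4; 6; 3]; [:: 5; 8; 9;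
      7]]; [:: [:: 2; 6; 9; 5]; [:: 4; 8; 11; 7]]; [:: [:: 1; 5; 4; 3]; [:: 6; 10; 7;
      8]]])).
by vm_compute.
Qed.

Lemma block4_4_6 : has_block4 [:: 4; 6].
Proof.
apply: (block_certificate
  (P := [:: [:: [:: 0; 4; 3; 5; 1; 2]; [:: 6; 9; 7; 8]]; [:: [:: 2; 6; 5; 4; 7; 3];
      [:: 8; 11; 10; 9]]; [:: [:: 2; 5; 8; 4]; [:: 6; 10; 13; 9; 11; 7]]; [:: [:: 1;
      4; 6; 3]; [:: 5; 9; 12; 8; 10; 7]]])).
by vm_compute.
Qed.

Lemma block4_4_5_5 : has_block4 [:: 4; 5; 5].
Proof.
apply: (block_certificate
  (P := [:: [:: [:: 0; 4; 5; 1; 2]; [:: 3; 7; 11; 8; 6]; [:: 9; 13; 12; 10]];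
      [:: [:: 2; 6; 7; 4; 3]; [:: 5; 9; 12; 8]; [:: 10; 14; 15; 11; 13]]; [:: [:: 2;
      5; 7; 8; 4]; [:: 6; 10; 11; 9]; [:: 12; 15; 13; 17; 14]]; [:: [:: 1; 4; 6; 5;
      3]; [:: 7; 10; 8; 9]; [:: 11; 14; 13; 16; 12]]])).
by vm_compute.
Qed.

Lemma block4_4_4_4_5 : has_block4 [:: 4; 4; 4; 5].
Proof.
apply: (block_certificate
  (P := [:: [:: [:: 0; 4; 1; 2]; [:: 3; 7; 10; 6]; [:: 5; 9; 12; 8]; [:: 11; 14; 15;
      16; 13]]; [:: [:: 2; 6; 5; 3]; [:: 4; 8; 11; 7]; [:: 9; 13; 12; 10]; [:: 14; 18;
      15; 17; 16]]; [:: [:: 2; 5; 7; 6; 4]; [:: 8; 10; 11; 9]; [:: 12; 15; 13; 14];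
      [:: 16; 20; 17; 18]]; [:: [:: 1; 5; 4; 3]; [:: 6; 9; 7; 8]; [:: 10; 14; 17; 13];
      [:: 11; 15; 19; 16; 12]]])).
by vm_compute.
Qed.

Definition open_vertices4 := nth [::] [:: [:: 0; 1]; [:: 1; 2]; [:: 0; 1; 3]; [:: 0; 2]].
Definition open_start4 := nth 0 [:: 0; 1; 1; 0].
Definition open_end4 := nth 0 [:: 1; 2; 3; 2].

Notation is_open4 := (is_open 4 [:: 1; 2; 3; 4] used_edges4 used_vertices4
  open_vertices4 open_start4 open_end4).
Notation is_closure4 := (is_closure 4 [:: 1; 2; 3; 4] used_edges4 used_vertices4
  open_vertices4 open_start4 open_end4).

Lemma extension4 : is_extension 4 [:: 1; 2; 3; 4] open_vertices4 open_start4 open_end4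
  (nth [::] [:: [:: 4]; [:: 5]; [:: 5; 2; 4]; [:: 4; 3; 1]])
      (nth [::] [:: [:: 2; 3; 5]; [:: 0; 3; 6]; [:: 7]; [:: 6]]) 4.
Proof. by vm_compute. Qed.

Lemma block4_long k : 7 <= k -> has_block4 [:: k].
Proof.
move=> kmin.
have op : is_open4
    (nth [::] [:: [::]; [::]; [::]; [::]])
      (nth [::] [:: [:: 5; 1; 2; 0; 4; 3; 6]; [:: 6; 4; 2; 3; 7]; [:: 6; 2; 5; 4; 8];
          [:: 5; 3; 1; 4; 7]]) 5
      by vm_compute.
have -> : k = 7 + 4 * ((k - 7) %/ 4) + (k - 7) %% 4 by lia.
have := ltn_pmod (k - 7) (isT : 0 < 4).
move: (_ %/ _) (_ %% _) => m [|[|[|[|j]]]] //= _.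
- have cl : is_closure4
      (nth [::] [:: [::]; [:: 0; 3]; [:: 2; 5]; [:: 1; 4]])
      (nth [::] [:: [::]; [::]; [::]; [::]]) 2
      by vm_compute.
  by apply: (closure_family (L := [::]) (m := m) op extension4 cl) => //=; lia.
- have cl : is_closure4
      (nth [::] [:: [:: 2]; [:: 3; 4; 0]; [:: 6; 2; 4]; [:: 5; 1; 3]])
      (nth [::] [:: [::]; [::]; [::]; [::]]) 3
      by vm_compute.
  by apply: (closure_family (L := [::]) (m := m) op extension4 cl) => //=; lia.
- have cl : is_closure4
      (nth [::] [:: [:: 2; 3]; [:: 0; 4; 5; 3]; [:: 7; 4; 2; 5]; [:: 6; 3; 4; 1]])
      (nth [::] [:: [::]; [::]; [::]; [::]]) 4
      by vm_compute.
  by apply: (closure_family (L := [::]) (m := m) op extension4 cl) => //=; lia.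
- have cl : is_closure4
      (nth [::] [:: [:: 3; 2; 4]; [:: 0; 3; 6; 4; 5]; [:: 4; 8; 5; 6; 2]; [:: 5; 3; 7;
          4; 1]])
      (nth [::] [:: [::]; [::]; [::]; [::]]) 5
      by vm_compute.
  by apply: (closure_family (L := [::]) (m := m) op extension4 cl) => //=; lia.
Qed.

Lemma block4_3_long k : 10 <= k -> has_block4 [:: 3; k].
Proof.
move=> kmin.
have op : is_open4
    (nth [::] [:: [:: [:: 3; 7; 6]]; [:: [:: 2; 5; 3]]; [::]; [:: [:: 1; 4; 3]]])
      (nth [::] [:: [:: 8; 4; 0; 2; 1; 5; 9]; [:: 9; 7; 4; 6; 10]; [:: 9; 6; 2; 4; 5;
          8; 7; 11]; [:: 8; 6; 5; 7; 10]]) 8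
      by vm_compute.
have -> : k = 10 + 4 * ((k - 10) %/ 4) + (k - 10) %% 4 by lia.
have := ltn_pmod (k - 10) (isT : 0 < 4).
move: (_ %/ _) (_ %% _) => m [|[|[|[|j]]]] //= _.
- have cl : is_closure4
      (nth [::] [:: [:: 3; 2; 4]; [:: 0; 3; 4; 6; 5]; [:: 6; 2]; [:: 5; 3; 7; 4; 1]])
      (nth [::] [:: [::]; [::]; [:: [:: 4; 8; 5]]; [::]]) 5
      by vm_compute.
  by apply: (closure_family (L := [:: 3]) (m := m) op extension4 cl) => //=; lia.
- have cl : is_closure4
      (nth [::] [:: [:: 5; 2; 3; 4]; [:: 0; 3; 6; 7; 5; 4]; [:: 7; 4; 2]; [:: 6; 4; 8;
          5; 3; 1]])
      (nth [::] [:: [::]; [::]; [:: [:: 5; 9; 6]]; [::]]) 6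
      by vm_compute.
  by apply: (closure_family (L := [:: 3]) (m := m) op extension4 cl) => //=; lia.
- have cl : is_closure4
      (nth [::] [:: [:: 5; 3; 2; 6; 4]; [:: 0; 3; 7; 8; 6; 5; 4]; [:: 4; 8; 5; 2];
          [:: 4; 7; 5; 9; 6; 3; 1]])
      (nth [::] [:: [::]; [::]; [:: [:: 6; 10; 7]]; [::]]) 7
      by vm_compute.
  by apply: (closure_family (L := [:: 3]) (m := m) op extension4 cl) => //=; lia.
- have cl : is_closure4
      (nth [::] [:: [:: 5; 6; 2; 3; 7; 4]; [:: 0; 3; 6; 7; 9; 8; 5; 4]; [:: 4; 6; 9;
          5; 2]; [:: 4; 8; 6; 10; 7; 5; 3; 1]])
      (nth [::] [:: [::]; [::]; [:: [:: 7; 11; 8]]; [::]]) 8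
      by vm_compute.
  by apply: (closure_family (L := [:: 3]) (m := m) op extension4 cl) => //=; lia.
Qed.

(** A closure sees only the boundary. As the additional 4-cycles lie in the open block, the four
    closures for a single long cycle serve again. *)
Lemma block4_4_long k : 7 <= k -> has_block4 [:: 4; k].
Proof.
move=> kmin.
have op : is_open4
    (nth [::] [:: [:: [:: 0; 4; 1; 2]]; [:: [:: 2; 4; 6; 3]]; [:: [:: 2; 6; 9; 5]];
        [:: [:: 1; 5; 4; 3]]])
      (nth [::] [:: [:: 9; 8; 7; 3; 5; 6; 10]; [:: 10; 8; 5; 7; 11]; [:: 10; 7; 4; 8;
          12]; [:: 9; 7; 6; 8; 11]]) 9
      by vm_compute.
have -> : k = 7 + 4 * ((k - 7) %/ 4) + (k - 7) %% 4 by lia.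
have := ltn_pmod (k - 7) (isT : 0 < 4).
move: (_ %/ _) (_ %% _) => m [|[|[|[|j]]]] //= _.
- have cl : is_closure4
      (nth [::] [:: [::]; [:: 0; 3]; [:: 2; 5]; [:: 1; 4]])
      (nth [::] [:: [::]; [::]; [::]; [::]]) 2
      by vm_compute.
  by apply: (closure_family (L := [:: 4]) (m := m) op extension4 cl) => //=; lia.
- have cl : is_closure4
      (nth [::] [:: [:: 2]; [:: 3; 4; 0]; [:: 6; 2; 4]; [:: 5; 1; 3]])
      (nth [::] [:: [::]; [::]; [::]; [::]]) 3
      by vm_compute.
  by apply: (closure_family (L := [:: 4]) (m := m) op extension4 cl) => //=; lia.
- have cl : is_closure4
      (nth [::] [:: [:: 2; 3]; [:: 0; 4; 5; 3]; [:: 7; 4; 2; 5]; [:: 6; 3; 4; 1]])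
      (nth [::] [:: [::]; [::]; [::]; [::]]) 4
      by vm_compute.
  by apply: (closure_family (L := [:: 4]) (m := m) op extension4 cl) => //=; lia.
- have cl : is_closure4
      (nth [::] [:: [:: 3; 2; 4]; [:: 0; 3; 6; 4; 5]; [:: 4; 8; 5; 6; 2]; [:: 5; 3; 7;
          4; 1]])
      (nth [::] [:: [::]; [::]; [::]; [::]]) 5
      by vm_compute.
  by apply: (closure_family (L := [:: 4]) (m := m) op extension4 cl) => //=; lia.
Qed.

Lemma block4_4_3_long k : 5 <= k -> has_block4 [:: 4; 3; k].
Proof.
move=> kmin.
have op : is_open4
    (nth [::] [:: [:: [:: 0; 4; 1; 2]; [:: 5; 9; 8]]; [:: [:: 2; 4; 3]; [:: 5; 7; 9;
        6]]; [:: [:: 2; 6; 4; 5]; [:: 7; 10; 8]]; [:: [:: 1; 5; 3]; [:: 4; 8; 6; 7]]])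
      (nth [::] [:: [:: 10; 6; 3; 7; 11]; [:: 11; 8; 12]; [:: 11; 9; 13]; [:: 10; 9;
          12]]) 10
      by vm_compute.
have -> : k = 5 + 4 * ((k - 5) %/ 4) + (k - 5) %% 4 by lia.
have := ltn_pmod (k - 5) (isT : 0 < 4).
move: (_ %/ _) (_ %% _) => m [|[|[|[|j]]]] //= _.
- have cl : is_closure4
      (nth [::] [:: [::]; [:: 0; 3]; [:: 2; 5]; [:: 1; 4]])
      (nth [::] [:: [::]; [::]; [::]; [::]]) 2
      by vm_compute.
  by apply: (closure_family (L := [:: 4; 3]) (m := m) op extension4 cl) => //=; lia.
- have cl : is_closure4
      (nth [::] [:: [:: 2]; [:: 3; 4; 0]; [:: 6; 2; 4]; [:: 5; 1; 3]])
      (nth [::] [:: [::]; [::]; [::]; [::]]) 3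
      by vm_compute.
  by apply: (closure_family (L := [:: 4; 3]) (m := m) op extension4 cl) => //=; lia.
- have cl : is_closure4
      (nth [::] [:: [:: 2; 3]; [:: 0; 4; 5; 3]; [:: 7; 4; 2; 5]; [:: 6; 3; 4; 1]])
      (nth [::] [:: [::]; [::]; [::]; [::]]) 4
      by vm_compute.
  by apply: (closure_family (L := [:: 4; 3]) (m := m) op extension4 cl) => //=; lia.
- have cl : is_closure4
      (nth [::] [:: [:: 3; 2; 4]; [:: 0; 3; 6; 4; 5]; [:: 4; 8; 5; 6; 2]; [:: 5; 3; 7;
          4; 1]])
      (nth [::] [:: [::]; [::]; [::]; [::]]) 5
      by vm_compute.
  by apply: (closure_family (L := [:: 4; 3]) (m := m) op extension4 cl) => //=; lia.
Qed.

(** * Lists of cycle lengths allowed by the inequality *)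

Definition admissible (L : seq nat) :=
  all (leq 3) L && (count_mem 3 L <= count_mem 5 L + count (leq 7) L).

Lemma admissible_perm L L' : perm_eq L L' -> admissible L = admissible L'.
Proof. by move=> pL; rewrite /admissible (perm_all _ pL) !(seq.permP pL). Qed.

(** A triangle makes the left-hand side of the inequality positive, so it has a partner on the
    right; removing both lowers each side by one. *)
Lemma admissible_triangle L : admissible L -> 3 \in L ->
  exists x L', [/\ (x == 5) || (7 <= x), perm_eq L ([:: 3; x] ++ L') & admissible L'].
Proof.
move=> aL L3.
have [x xL x57] : exists2 x, x \in L & (x == 5) || (7 <= x).
  apply/hasP; rewrite has_count.
  have c3 : 0 < count_mem 3 L by rewrite -has_count has_pred1.
  have /andP[_ le] := aL.
  have -> : count (fun x => (x == 5) || (7 <= x)) L = count_mem 5 L + count (leq 7) L.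
    rewrite -count_predUI [X in _ + X](eq_count (a2 := pred0)) ?count_pred0 ?addn0 //.
    by move=> y /=; apply/negbTE; lia.
  lia.
have nx3 : x != 3 by lia.
have p3 := perm_to_rem L3.
have xL' : x \in rem 3 L by move: xL; rewrite (perm_mem p3) inE (negbTE nx3).
have px : perm_eq L ([:: 3; x] ++ rem x (rem 3 L)).
  by apply: perm_trans p3 _; rewrite perm_cons; apply: perm_to_rem.
exists x, (rem x (rem 3 L)); split=> //.
by move: aL; rewrite (admissible_perm px) /admissible /=; lia.
Qed.

Lemma admissible_cons k L : k != 3 -> 3 \notin L -> admissible (k :: L) -> admissible L.
Proof.
rewrite /admissible /= => k3 /count_memPn -> /andP[/andP[_ ->]] //.
Qed.

Section AdmissibleBlocks.

Variables (K : nat) (S : seq nat) (D : seq (nat * nat)) (B : nat -> seq nat).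
Notation has_block := (has_block K S D B).

Hypothesis single : forall k, 5 <= k -> has_block [:: k].
Hypothesis triangle : forall k, (k == 5) || (7 <= k) -> has_block [:: 3; k].

(** A block with a single 4-cycle is demanded only if 4 occurs. Thus the lemma also serves {1, 2, 3,
    4}, once the 4s have been taken out of the list. *)
Lemma admissible_has_block L : (4 \in L -> has_block [:: 4]) ->
  admissible L -> has_block L.
Proof.
have [n] := ubnP (size L); elim: n L => // n IH L szL h4 aL.
have [L3|L3] := boolP (3 \in L).
  have [x [L' [x57 px aL']]] := admissible_triangle aL L3.
  apply: (has_block_perm (L := [:: 3; x] ++ L')); first by rewrite perm_sym.
  apply: has_block_cat; first exact: triangle.
  apply: IH => //; first by move: szL; rewrite (perm_size px) /=; lia.
  by move=> h; apply: h4; rewrite (perm_mem px) mem_cat h orbT.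
case: L aL L3 szL h4 => [|k L] aL L3 szL h4; first exact: has_block_nil.
have k3 : 3 <= k by case/andP: aL => /=/andP[].
move: L3; rewrite inE negb_or eq_sym => /andP[nk3 L3].
rewrite -cat1s; apply: has_block_cat.
  case: (ltnP 4 k) => [|k4]; first exact: single.
  by have -> : k = 4; [lia | apply: h4; rewrite inE; lia].
apply: IH => //; first by move=> h; apply: h4; rewrite inE h orbT.
exact: admissible_cons aL.
Qed.

End AdmissibleBlocks.

Lemma admissible_has_block3 L : admissible L -> has_block3 L.
Proof.
apply: admissible_has_block => [k k5|k k57|_]; last exact: block3_4.
  case: (ltnP k 6) => h; last exact: block3_long.
  by have -> : k = 5; [lia | exact: block3_5].
case: (ltnP k 9) => h; last exact: block3_3_long.
have : k \in [:: 5; 7; 8] by rewrite !inE; lia.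
by rewrite !inE => /or3P[] /eqP ->;
  [exact: block3_3_5 | exact: block3_3_7 | exact: block3_3_8].
Qed.

Lemma single4 k : 5 <= k -> has_block4 [:: k].
Proof.
case: (ltnP k 7) => h k5; last exact: block4_long.
have : k \in [:: 5; 6] by rewrite !inE; lia.
by rewrite !inE => /orP[] /eqP ->; [exact: block4_5 | exact: block4_6].
Qed.

Lemma triangle4 k : (k == 5) || (7 <= k) -> has_block4 [:: 3; k].
Proof.
case: (ltnP k 10) => h k57; last exact: block4_3_long.
have : k \in [:: 5; 7; 8; 9] by rewrite !inE; lia.
by rewrite !inE => /or4P[] /eqP ->;
  [exact: block4_3_5 | exact: block4_3_7 | exact: block4_3_8 | exact: block4_3_9].
Qed.

(* No block consists of a single 4-cycle, so 4-cycles are used in pairs and a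
   last one is attached to some other cycles. *)
Lemma admissible_has_block4 L :
  admissible L -> odd (sumn L) -> sumn L != 9 -> has_block4 L.
Proof.
move=> aL oL n9.
set R := [seq k <- L | k != 4].
set m := count_mem 4 L.
have pL : perm_eq L (nseq m 4 ++ R).
  rewrite perm_sym /m -size_filter.
  by have /all_pred1P <- := filter_all (pred1 4) L; exact: permEl (perm_filterC _ _).
have R4 : 4 \notin R by rewrite mem_filter.
have fours j : has_block4 (nseq j.*2 4).
  elim: j => [|j IH]; first exact: has_block_nil.
  by rewrite doubleS; apply: (has_block_cat (L := [:: 4; 4])) block4_4_4 IH.
have blk R' : {subset R' <= R} -> admissible R' -> has_block4 R'.
  move=> sR; apply: (admissible_has_block single4 triangle4) => /sR.
  by rewrite (negbTE R4).
have aR : admissible R.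
  move: aL; rewrite (admissible_perm pL) /admissible all_cat !count_cat !count_nseq.
  by rewrite /= !mul0n => /andP[/andP[_ ->]].
apply: has_block_perm (_ : has_block4 (nseq m 4 ++ R)); first by rewrite perm_sym.
have [om|em] := boolP (odd m); last first.
  apply: has_block_cat; last exact: blk.
  by rewrite -[m]odd_double_half (negbTE em); apply: fours.
have em : m = (m./2).*2.+1 by rewrite -[LHS]odd_double_half om.
set j := m./2 in em.
have -> : nseq m 4 ++ R = nseq j.*2 4 ++ (4 :: R).
  by rewrite em -addn1 nseqD -catA.
(* The odd 4 joins a triangle with its partner, a cycle of length at least 6, or two 5-cycles.
   Otherwise [R] has at most one entry, a 5: the empty [R] is excluded by parity, and a lone 5 needs
   two more 4s, which exist because the sum is not 4 + 5 = 9. *)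
suff: has_block4 (4 :: R) \/ (0 < j /\ R = [:: 5]).
  case=> [b|[j0 ->]]; first exact: has_block_cat.
  have -> : nseq j.*2 4 ++ [:: 4; 5] = nseq j.-1.*2 4 ++ [:: 4; 4; 4; 5].
    by rewrite -[in LHS](prednK j0) doubleS -addn2 nseqD -catA.
  by apply: has_block_cat => //; exact: block4_4_4_4_5.
have with_four s R' : perm_eq R (s ++ R') -> has_block4 (4 :: s) -> admissible R' ->
    has_block4 (4 :: R).
  move=> pR b aR'; apply: (has_block_perm (L := (4 :: s) ++ R')).
    by rewrite /= perm_cons perm_sym.
  apply: has_block_cat => //; apply: blk => // x xR'.
  by rewrite (perm_mem pR) mem_cat xR' orbT.
have [R3|R3] := boolP (3 \in R).
  left; have [x [R' [x57 pR aR']]] := admissible_triangle aR R3.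
  apply: with_four pR _ aR'; apply: block4_4_3_long; lia.
have rem_ok s R' : perm_eq R (s ++ R') -> admissible R'.
  move=> pR; move: aR R3; rewrite (admissible_perm pR) (perm_mem pR) mem_cat negb_or.
  rewrite /admissible all_cat => /andP[/andP[_ ->] _] /andP[_ /count_memPn ->] //.
have [/hasP[x xR x6]|/hasPn all5] := boolP (has (leq 6) R).
  left; apply: (with_four [:: x] (rem x R)); first exact: perm_to_rem.
    case: (ltnP x 7) => h; last exact: block4_4_long.
    by have -> : x = 6; [lia | exact: block4_4_6].
  exact: (rem_ok [:: x] _ (perm_to_rem xR)).
have R5 : R = nseq (size R) 5.
  apply/all_pred1P/allP => x xR /=; have := all5 x xR.
  have : x != 4 by apply: contraNneq R4 => <-.
  have : x != 3 by apply: contraNneq R3 => <-.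
  have /andP[/allP/(_ x xR) /=] := aR; lia.
have sz : sumn L = 4 * m + 5 * size R.
  by rewrite (perm_sumn pL) sumn_cat [in sumn R]R5 !sumn_nseq.
case: (ltnP 1 (size R)) => h.
  left; apply: (with_four [:: 5; 5] (nseq (size R - 2) 5)).
  - by rewrite [in X in perm_eq X _]R5 -{1}(subnKC h) nseqD.
  - exact: block4_4_5_5.
  - by apply: (rem_ok [:: 5; 5]); rewrite [in X in perm_eq X _]R5 -{1}(subnKC h) nseqD.
right; have s1 : size R = 1.
  by move: h oL; rewrite sz oddD !oddM; case: (size R) => [|[|k]].
by split; [move: n9; rewrite sz; lia | rewrite R5 s1].
Qed.

(** * Two-regular graphs as lists of cycles *)

Definition cycle_adj (T : eqType) (ss : seq (seq T)) : rel T := fun x y =>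
  let E := flatten (map (@cycle_pairs T) ss) in ((x, y) \in E) || ((y, x) \in E).

Lemma mem_cycle_pairs (T : eqType) (c : seq T) x y : uniq c ->
  ((x, y) \in cycle_pairs c) = (x \in c) && (y == next c x).
Proof.
case: c => // z s uc.
have sz : size (z :: s) = size (rot 1 (z :: s)) by rewrite size_rot.
have nextE i : i < size (z :: s) ->
    nth z (rot 1 (z :: s)) i = next (z :: s) (nth z (z :: s) i).
  move=> il; rewrite next_nth mem_nth // index_uniq // rot1_cons nth_rcons.
  move: il; rewrite /= ltnS leq_eqVlt => /orP[/eqP ->|-> //].
  (* At the last index the default [z] of [nth] is the successor, since the cycle wraps around to
     its first vertex. *)
  by rewrite ltnn eqxx nth_default.
apply/idP/andP => [|[xc /eqP ->]].
  case/(nthP (z, z)) => i; rewrite size_zip -sz minnn => il.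
  by rewrite nth_zip // nextE // => -[<- <-]; rewrite mem_nth.
apply/(nthP (z, z)); exists (index x (z :: s)); first by rewrite size_zip -sz minnn index_mem.
by rewrite nth_zip // nextE ?index_mem // nth_index.
Qed.

Lemma next_neq_prev (T : eqType) (c : seq T) x :
  uniq c -> 2 < size c -> x \in c -> next c x != prev c x.
Proof.
move=> uc sc xc; case/rot_to: (xc) => i s rs.
have us : uniq (x :: s) by rewrite -rs rot_uniq.
rewrite -(next_rot i uc) -(prev_rot i uc) rs.
have : 1 < size s by move: sc; rewrite -(size_rot i) rs.
case: s us {rs} => [|y [|z s]] // /andP[xs /andP[ys _]] _.
rewrite prev_nth mem_head (memNindex xs) -last_nth /= eqxx.
by apply: contraNneq ys => ->; apply: mem_last.
Qed.

Section TwoRegular.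

Variables (V : finType) (F : sgraph V).
Hypothesis F2 : regular F 2.

Lemma neighbour_pair x : exists y z,
  [/\ y != z, F x y, F x z & forall w, F x w -> w = y \/ w = z].
Proof.
have /eqP := F2 x; rewrite -[X in X == 2]cardsE => /cards2P[y [z [yz /setP e]]].
exists y, z; split=> //.
- by have := e y; rewrite !inE eqxx /= => ->.
- by have := e z; rewrite !inE eqxx orbT => ->.
by move=> w Fw; have := e w; rewrite !inE Fw => /esym/orP[]/eqP; [left|right].
Qed.

Lemma third_neighbour x y z w : F x y -> F x z -> y != z -> F x w -> w = y \/ w = z.
Proof.
move=> xy xz yz xw; have [a [b [_ _ _ h]]] := neighbour_pair x.
move: (h _ xy) (h _ xz) (h _ xw) yz.
by do 3 case=> ->; rewrite ?eqxx; auto.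
Qed.

Definition adj_closed (A : {set V}) := forall x y, x \in A -> F x y -> y \in A.

(** A path is grown at [x], with [p] the earlier vertices in reverse order. When it cannot be
    extended, both neighbours of [x] lie on [p]. One of them is not the head of [p], and closing up
    there gives at least three vertices. *)
Lemma cycle_in_closed A : adj_closed A -> A != set0 ->
  exists c, [/\ ucycle F c, 2 < size c & {subset c <= A}].
Proof.
move=> clA /set0Pn[a aA].
suff ext n x p : #|V| - size p <= n -> path F x p -> uniq (x :: p) -> {subset x :: p <= A} ->
    exists c, [/\ ucycle F c, 2 < size c & {subset c <= A}].
  by apply: (ext #|V| a [::]) => // [|x]; rewrite ?leq_subr // inE => /eqP ->.
elim: n x p => [|n IH] x p szp Fp up sp;
  have szV : (size p).+1 <= #|V| by rewrite -[(size p).+1]/(size (x :: p)) -(card_uniqP up) max_card.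
  by move: szp szV; lia.
have xA : x \in A by apply: sp; rewrite mem_head.
case/boolP: [exists y, F x y && (y \notin x :: p)] => [/existsP[y /andP[xy yp]]|].
  apply: (IH y (x :: p)).
  - by move: szp szV => /=; lia.
  - by rewrite /= adj_sym xy.
  - by rewrite cons_uniq yp.
  - by move=> w; rewrite inE => /orP[/eqP ->|/sp //]; apply: clA xy.
rewrite negb_exists => /forallP noext.
have inp y : F x y -> y \in p.
  move=> xy; have := noext y; rewrite xy negbK inE => /orP[/eqP yx|//].
  by rewrite yx adj_irr in xy.
have [y [z [yz xy xz _]]] := neighbour_pair x.
wlog yh : y z yz xy xz / y != head x p.
  move=> wl; have [yh|] := eqVneq y (head x p); last exact: wl xy xz.
  by apply: (wl z y); rewrite // ?[z == y]eq_sym // -yh eq_sym.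
case/splitPr: (inp y xy) Fp up sp yh => p1 p2 Fp up sp yh.
exists (x :: rcons p1 y); split.
- apply/andP; split.
    rewrite /= rcons_path last_rcons adj_sym xy andbT.
    by move: Fp; rewrite -cat_rcons cat_path => /andP[].
  by move: up; rewrite -cat_rcons -cat_cons cat_uniq => /andP[].
- by case: p1 {Fp up sp inp noext szp} yh => [|u p1] //=; rewrite ?eqxx // size_rcons.
by move=> w wc; apply: sp; rewrite -cat_rcons -cat_cons mem_cat wc.
Qed.

Lemma ucycle_adj c x y : ucycle F c -> 2 < size c -> x \in c ->
  F x y = (y == next c x) || (y == prev c x).
Proof.
case/andP=> Fc uc sc xc.
have Fn := next_cycle Fc xc; have := prev_cycle Fc xc; rewrite adj_sym => Fp.
apply/idP/orP => [xy|[]/eqP-> //].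
by case: (third_neighbour Fn Fp (next_neq_prev uc sc xc) xy) => ->; rewrite eqxx; auto.
Qed.

Lemma ucycle_closed c : ucycle F c -> 2 < size c -> adj_closed [set x in c].
Proof.
move=> Fc sc x y; rewrite !inE => xc; rewrite (ucycle_adj _ Fc sc xc).
by case/orP=> /eqP ->; rewrite ?mem_next ?mem_prev.
Qed.

(** Cycles can be split off one at a time: by 2-regularity the vertices of a cycle are closed under
    adjacency, hence so are the remaining ones. *)
Lemma closed_cover A : adj_closed A ->
  exists ss, [/\ uniq (flatten ss), flatten ss =i A
    & {in ss, forall c, ucycle F c /\ 2 < size c}].
Proof.
have [n] := ubnP #|A|; elim: n A => // n IH A An clA.
have [->|A0] := eqVneq A set0; first by exists [::]; split=> // x; rewrite inE.
have [c [Fc sc cA]] := cycle_in_closed clA A0.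
have [||ss [us ess hss]] := IH (A :\: [set x in c]).
- have e : #|A :&: [set x in c]| = size c.
    have /andP[_ /card_uniqP <-] := Fc; rewrite -[RHS]cardsE; congr #|pred_of_set _|.
    by apply/setIidPr/subsetP => x; rewrite inE => /cA.
  move: (subset_leq_card (subsetIl A [set x in c])) An sc.
  by rewrite cardsD e; lia.
- move=> x y; rewrite !inE => /andP[xc xA] xy; rewrite (clA x) // andbT.
  apply: contra xc => yc; have := @ucycle_closed c Fc sc y x; rewrite !inE adj_sym.
  by apply.
exists (c :: ss); split.
- rewrite /= cat_uniq us andbT; have /andP[_ ->] := Fc.
  by apply/hasPn => x; rewrite ess !inE => /andP[].
- move=> x; rewrite /= mem_cat ess !inE.
  by case: (boolP (x \in c)) => //= /cA ->.
- by move=> d; rewrite inE => /orP[/eqP ->|/hss].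
Qed.

Lemma closed_sub_cycle A c x : adj_closed A -> path.cycle F c -> x \in c -> x \in A ->
  {subset c <= A}.
Proof.
move=> clA Fc xc xA; case/rot_to: (xc) => i s rs y.
rewrite -(mem_rot i) rs; move: Fc; rewrite -(rot_cycle i) rs /= rcons_path => /andP[+ _].
elim: s x xA {xc rs} => [|z s IH] x xA /=; first by rewrite inE => _ /eqP ->.
case/andP=> xz zs; rewrite inE => /orP[/eqP -> //|]; apply: IH zs.
exact: clA xz.
Qed.

(** For a cycle of a 2-regular graph this is its edge set, written so that it visibly depends on the
    vertex set alone. *)
Definition edges_at (A : {set V}) : {set {set V}} :=
  [set e : {set V} | [exists x in A, exists y, F x y && (e == [set x; y])]].

Lemma cycle_edges_at c : ucycle F c -> 2 < size c ->
  cycle_edges c = edges_at [set x in c].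
Proof.
move=> Fc sc; apply/setP => e; rewrite inE; apply/imsetP/existsP.
  case=> x xc ->; exists x; rewrite inE xc; apply/existsP; exists (next c x).
  by rewrite eqxx andbT; have /andP[/next_cycle -> ] := Fc.
case=> x /andP[]; rewrite inE => xc /existsP[y /andP[]].
rewrite (ucycle_adj _ Fc sc xc) => /orP[] /eqP -> /eqP ->; first by exists x.
exists (prev c x); rewrite ?mem_prev // next_prev; first by rewrite setUC.
by have /andP[] := Fc.
Qed.

Lemma edges_at_subset A B :
  adj_closed A -> adj_closed B -> edges_at A = edges_at B -> A \subset B.
Proof.
move=> clA clB /setP e; apply/subsetP => x xA.
have [y [_ [_ xy _ _]]] := neighbour_pair x.
have := e [set x; y]; rewrite !inE.
have -> : [exists x0 in A, exists y0, F x0 y0 && ([set x; y] == [set x0; y0])].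
  apply/existsP; exists x; rewrite xA; apply/existsP; exists y; by rewrite xy eqxx.
case/esym/existsP => z /andP[zB /existsP[w /andP[zw /eqP/setP/(_ x)]]].
by rewrite !inE eqxx /= => /esym/orP[] /eqP -> //; apply: clB zw.
Qed.

Lemma two_regular_cycles : exists ss,
  [/\ uniq (flatten ss), forall x, x \in flatten ss,
      {in ss, forall c, ucycle F c /\ 2 < size c} & F =2 cycle_adj ss].
Proof.
have [|ss [us ess hss]] := closed_cover (A := setT); first by move=> x y; rewrite !inE.
exists ss; split=> // [x|x y]; first by rewrite ess inE.
have /flattenP[c css xc] : x \in flatten ss by rewrite ess inE.
have [Fc sc] := hss _ css; have /andP[_ uc] := Fc.
have mem_pairs u v : ((u, v) \in flatten (map (@cycle_pairs V) ss)) ->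
    exists d, [/\ d \in ss, u \in d & v = next d u].
  case/flattenP => E /mapP[d dss ->]; have [/andP[_ ud] _] := hss _ dss.
  by rewrite mem_cycle_pairs // => /andP[ud' /eqP ->]; exists d.
have pairs_mem d u : d \in ss -> u \in d ->
    (u, next d u) \in flatten (map (@cycle_pairs V) ss).
  move=> dss ud; apply/flattenP; exists (cycle_pairs d); first exact: map_f.
  by rewrite mem_cycle_pairs ?ud ?eqxx //; have [/andP[]] := hss _ dss.
apply/idP/idP => [|/orP[] /mem_pairs[d [dss ud ->]]].
- rewrite (ucycle_adj _ Fc sc xc) => /orP[] /eqP ->; rewrite /cycle_adj /=.
    by rewrite pairs_mem.
  have := pairs_mem c (prev c x) css; rewrite mem_prev next_prev // => -> //.
  by rewrite orbT.
- by have [/andP[/next_cycle -> ]] := hss _ dss.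
- by have [/andP[/next_cycle h _] _] := hss _ dss; rewrite adj_sym h.
Qed.

(** A cycle of [F] that meets a member of [ss] has the same vertices, as both are closed under
    adjacency, and so the same edges. Distinct members are disjoint and have distinct edge sets. *)
Lemma num_cycles_count ss m :
  uniq (flatten ss) -> (forall x, x \in flatten ss) ->
  {in ss, forall c, ucycle F c /\ 2 < size c} -> 2 < m ->
  num_cycles F m = count_mem m (map size ss).
Proof.
move=> us ess hss m2.
have same_cycle c d x : c \in ss -> d \in ss -> x \in c -> x \in d -> c = d.
  elim: ss us {ess hss} => // e ss IH /=.
  rewrite cat_uniq => /and3P[_ /hasPn dis uss].
  have out f : f \in ss -> x \in f -> x \notin e.
    by move=> fss xf; apply: dis; apply/flattenP; exists f.
  rewrite !inE => /orP[/eqP ->|cs] /orP[/eqP ->|ds] xc xd //; last exact: IH.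
    by rewrite (negbTE (out _ ds xd)) in xc.
  by rewrite (negbTE (out _ cs xc)) in xd.
have uss : uniq ss.
  elim: ss us hss {ess same_cycle} => // e ss IH /=.
  rewrite cat_uniq => /and3P[_ /hasPn dis uss] hss.
  rewrite IH // ?andbT => [|c css]; last by apply: hss; rewrite inE css orbT.
  have [_] := hss e (mem_head _ _); case: e dis {hss} => // x e dis _.
  apply/negP => ess; have /dis : x \in flatten ss.
    by apply/flattenP; exists (x :: e); rewrite ?mem_head.
  by rewrite mem_head.
have clc c : c \in ss -> adj_closed [set x in c].
  by move=> /hss[]; apply: ucycle_closed.
rewrite /num_cycles.
have -> : [set cycle_edges t | t : m.-tuple V & (2 < m) && ucycleb F t]%SET =
    [set:: [seq edges_at [set x in c] | c : seq V <- ss & size c == m]].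
  apply/setP => e; rewrite inE; apply/imsetP/mapP.
    case=> t; rewrite inE m2 => /andP[_ Ft] ->.
    have st : 2 < size t by rewrite size_tuple.
    have [x xt] : exists x, x \in tval t.
      by case: (tval t) st => // x s _; exists x; rewrite mem_head.
    have /flattenP[c css xc] := ess x.
    have [Fc sc] := hss _ css.
    have tc : tval t =i c.
      move=> y; apply/idP/idP => h.
        have := closed_sub_cycle (clc _ css) (proj1 (andP Ft)) xt.
        by rewrite inE => /(_ xc y h); rewrite inE.
      have := closed_sub_cycle (ucycle_closed Ft st) (proj1 (andP Fc)) xc.
      by rewrite inE => /(_ xt y h); rewrite inE.
    exists c.
      rewrite mem_filter css andbT -(card_uniqP (proj2 (andP Fc))) -(eq_card tc).
      by rewrite (card_uniqP (proj2 (andP Ft))) size_tuple.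
    rewrite cycle_edges_at //; congr edges_at; apply/setP => y; by rewrite !inE tc.
  case=> c; rewrite mem_filter => /andP[/eqP sc css] ->.
  have [Fc _] := hss _ css.
  exists (tcast sc (in_tuple c)); first by rewrite inE m2 val_tcast.
  by rewrite val_tcast cycle_edges_at // sc.
rewrite cardsE (card_uniqP _) ?size_map ?size_filter ?count_map //.
rewrite map_inj_in_uniq ?filter_uniq // => c d; rewrite !mem_filter.
move=> /andP[_ css] /andP[_ dss] /(edges_at_subset (clc _ css) (clc _ dss)) /subsetP sub.
have [x xc] : exists x, x \in c.
  by case: c {sub} css => [/hss[]|x s _] //; exists x; rewrite mem_head.
apply: (same_cycle _ _ x) => //.
by have := sub x; rewrite !inE; apply.
Qed.

End TwoRegular.

Lemma cycles_admissible (V : finType) (F : sgraph V) ss :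
  regular F 2 -> uniq (flatten ss) -> (forall x, x \in flatten ss) ->
  {in ss, forall c, ucycle F c /\ 2 < size c} ->
  num_cycles F 3 <= num_cycles F 5 + \sum_(7 <= i < #|V|.+1) num_cycles F i ->
  admissible (map size ss).
Proof.
move=> F2 us ess hss; rewrite /admissible.
have -> : all (leq 3) (map size ss).
  by apply/allP => k /mapP[c /hss[_ ?] ->].
rewrite !(num_cycles_count F2 us ess hss) //= => /leq_trans -> //.
rewrite leq_add2l (eq_big_nat _ _ (F2 := fun i => count_mem i (map size ss))); last first.
  by move=> i /andP[i7 _]; rewrite (num_cycles_count F2 us ess hss) //; lia.
elim: (map size ss) => [|k L IH] /=; first by rewrite big1.
rewrite big_split /= leq_add //.
case: (leqP 7 k) => k7; last first.
  by rewrite big_nat_cond big1 // => i /andP[/andP[i7 _] _] /=; case: eqP => // e;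
    move: k7; rewrite e ltnNge i7.
have [kV|kV] := ltnP k #|V|.+1; last first.
  by rewrite big_nat_cond big1 // => i /andP[/andP[i7 iV] _] /=; case: eqP => // e;
    move: kV; rewrite e leqNgt iV.
rewrite (bigD1_seq k) ?iota_uniq ?mem_index_iota ?k7 //= eqxx big1 // => i.
by rewrite eq_sym => /negbTE ->.
Qed.

(** * Graphs with the same cycle lengths are isomorphic *)

Section Isomorphism.

Variables (V W : eqType) (f : V -> W).

Lemma cycle_adj_map ss x y : injective f ->
  cycle_adj (map (map f) ss) (f x) (f y) = cycle_adj ss x y.
Proof.
move=> fi; rewrite /cycle_adj /= -map_comp.
have -> : flatten [seq cycle_pairs (map f c) | c <- ss] =
    map (fun e => (f e.1, f e.2)) (flatten (map (@cycle_pairs V) ss)).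
  by rewrite map_flatten -map_comp; congr flatten; apply: eq_map => c; apply: map_cycle_pairs.
have gi : injective (fun e : V * V => (f e.1, f e.2)) by move=> [a b] [c d] [/fi -> /fi ->].
by rewrite -[(f x, f y)]/((fun e : V * V => (f e.1, f e.2)) (x, y))
           -[(f y, f x)]/((fun e : V * V => (f e.1, f e.2)) (y, x)) !mem_map.
Qed.

End Isomorphism.

Lemma perm_map_preimage (T1 T2 : eqType) (h : T1 -> T2) (s : seq T1) (t : seq T2) :
  perm_eq (map h s) t -> exists2 s', perm_eq s s' & map h s' = t.
Proof.
elim: t s => [|y t IH] s p; first by exists s => //; apply/nilP; rewrite /nilp (perm_size p).
have : y \in map h s by rewrite (perm_mem p) mem_head.
case/mapP=> x xs yE; have px := perm_to_rem xs.
have [|s' ps' <-] := IH (rem x s).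
  by rewrite -(perm_cons y) yE -map_cons -yE -(permPl (perm_map h px)).
by exists (x :: s'); rewrite /= ?yE // (permPl px) perm_cons.
Qed.

(** Once the cycles are reordered so that lengths agree one by one, matching the two flattened lists
    position by position carries cycles to cycles. *)
Lemma same_shape_isomorphic (V W : finType) (G : sgraph V) (H : sgraph W) ss tt
    (x0 : V) (y0 : W) :
  uniq (flatten ss) -> (forall x, x \in flatten ss) -> G =2 cycle_adj ss ->
  uniq (flatten tt) -> (forall x, x \in flatten tt) -> H =2 cycle_adj tt ->
  perm_eq (map size ss) (map size tt) -> isomorphic G H.
Proof.
move=> us ess Gss ut ett Htt /perm_map_preimage[ss' pss shp].
have pf : perm_eq (flatten ss) (flatten ss') by apply: perm_flatten.
have us' : uniq (flatten ss') by rewrite -(perm_uniq pf).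
have ess' x : x \in flatten ss' by rewrite -(perm_mem pf).
have Gss' x y : G x y = cycle_adj ss' x y.
  rewrite Gss /cycle_adj /= !(perm_mem (perm_flatten (perm_map (@cycle_pairs V) pss))) //.
have szf : size (flatten ss') = size (flatten tt) by rewrite !size_flatten /shape shp.
pose f x := nth y0 (flatten tt) (index x (flatten ss')).
have fi : injective f.
  move=> x y /eqP; rewrite nth_uniq // -?szf ?index_mem // => /eqP.
  exact: index_inj.
have ftt : map (map f) ss' = tt.
  apply: eq_from_flatten_shape; last first.
    by rewrite /shape -shp -map_comp; apply: eq_map => c /=; rewrite size_map.
  rewrite -map_flatten; apply: (@eq_from_nth _ y0); rewrite size_map // => i il.
  by rewrite (nth_map x0) // /f index_uniq.
exists f; split.
  exists (fun y => nth x0 (flatten ss') (index y (flatten tt))) => [x|y].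
    by rewrite /f index_uniq -?szf ?index_mem ?nth_index.
  by rewrite /f index_uniq ?szf ?index_mem ?nth_index.
by move=> x y; rewrite Htt Gss' -ftt cycle_adj_map.
Qed.

(* Imported only here because it redefines [set0], [setT] etc. *)
From mathcomp Require Import classical_sets cardinality.

Import GRing.Theory.
Local Open Scope ring_scope.

(** * Primes for which 6 is a cube and 2 is not *)

(** Given the first equation, the second is a quadratic one in [c], proved as [e1]. Reducing the
    cubic modulo it leaves a linear equation, [c * b = w * (4 * m + 1)]. The hypothesis says that
    the root of the linear equation satisfies the quadratic one: it is the elimination of [c]. *)
Lemma cube_identities (K : fieldType) (w m : K) :
  6 != 0 :> K -> 7 != 0 :> K -> w ^+ 2 + w + 1 = 0 ->
  6 * m * w * (4 * m + 1) * (m * (3 + 2 * w) + 2 * w)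
    + (m * (3 + 2 * w) - w) * (m * (3 - 2 * w) + w) ^+ 2 = 0 ->
  exists c, 2 * c ^+ 3 = 1 + 2 * w /\ 2 * m * (1 + c) ^+ 3 = w.
Proof.
move=> n6 n7 w1 beta0.
have n2 : 2 != 0 :> K by apply: contraNneq n6 => e; rewrite (natrM _ 2 3) e mul0r.
have n3 : 3 != 0 :> K by apply: contraNneq n6 => e; rewrite (natrM _ 3 2) e mul0r.
have w0 : w != 0 by apply: contra_eq_neq w1 => ->; rewrite expr0n /= !add0r oner_neq0.
have m0 : m != 0.
  apply: contra_eq_neq beta0 => ->.
  have -> : 6 * 0 * w * (4 * 0 + 1) * (0 * (3 + 2 * w) + 2 * w) +
    (0 * (3 + 2 * w) - w) * (0 * (3 - 2 * w) + w) ^+ 2 = - w ^+ 3 by ring.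
  by rewrite oppr_eq0 expf_neq0.
(* If [b] were 0, the hypothesis would give [4 * m + 1 = 0], then [2 * w = 1], and
   [w ^+ 2 + w + 1 = 0] would make 7 vanish. *)
set b := m * (3 - 2 * w) + w in beta0 *.
have b0 : b != 0.
  apply/eqP => be; move: beta0; rewrite be expr0n /= mulr0 addr0.
  have -> : m * (3 + 2 * w) + 2 * w = b + w * (4 * m + 1) by rewrite /b; ring.
  rewrite be add0r => /eqP; rewrite !mulf_eq0 (negbTE n6) (negbTE m0) (negbTE w0) /= orbb.
  move=> /eqP m4; case/negP: n7; apply/eqP.
  have e4 : 4 * b = 3 * (2 * w - 1).
    rewrite /b -[RHS]addr0 -(mulr0 (3 - 2 * w)) -m4; ring.
  move: e4; rewrite be mulr0 => /esym/eqP; rewrite mulf_eq0 (negbTE n3) /= => /eqP e.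
  have -> : 7 = 4 * (w ^+ 2 + w + 1) - (2 * w - 1) * (2 * w + 3) :> K by ring.
  by rewrite w1 e; ring.
set c := w * (4 * m + 1) / b.
have cb : c * b = w * (4 * m + 1) by rewrite divfK.
have e1 : 6 * m * (c ^+ 2 + c) = - (m * (3 + 2 * w) - w).
  apply: (mulIf (expf_neq0 2 b0)).
  have -> : 6 * m * (c ^+ 2 + c) * b ^+ 2 = 6 * m * (c * b) * (c * b + b) by ring.
  rewrite cb (_ : w * (4 * m + 1) + b = m * (3 + 2 * w) + 2 * w); last by rewrite /b; ring.
  apply/eqP; rewrite -subr_eq0 mulNr opprK; apply/eqP; rewrite -[RHS]beta0; ring.
have c3 : 2 * c ^+ 3 = 1 + 2 * w.
  apply: (mulfI (mulf_neq0 n3 m0)).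
  have -> : 3 * m * (2 * c ^+ 3) =
    (c - 1) * (6 * m * (c ^+ 2 + c)) + 6 * m * c by ring.
  rewrite e1; have -> : (c - 1) * - (m * (3 + 2 * w) - w) + 6 * m * c =
    c * b + (m * (3 + 2 * w) - w) by rewrite /b; ring.
  by rewrite cb; ring.
exists c; split=> //.
have -> : 2 * m * (1 + c) ^+ 3 = 2 * m + 6 * m * (c ^+ 2 + c) + m * (2 * c ^+ 3) by ring.
by rewrite e1 c3; ring.
Qed.

(* The norm [X^2 - X Y + Y^2] of [X + Y w], which is 1/27 of the left-hand side
   in [cube_identities] at [m = - (3 y + 1)]. *)
Definition norm_value (y : nat) : nat :=
  (7 + 87 * y + 420 * y ^ 2 + 977 * y ^ 3 + 1122 * y ^ 4 + 681 * y ^ 5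
   + 343 * y ^ 6)%N.

(** A vanishing norm with [Y] nonzero yields [w = - X / Y], which is a root of [w ^+ 2 + w + 1] and
    at the same time kills [X + Y * w]. *)
Lemma cubic_pattern (K : fieldType) (y : nat) :
  {in [:: 2; 3; 7; 17; 37]%N, forall q, q%:R != 0 :> K} ->
  (norm_value y)%:R = 0 :> K ->
  exists w c : K, [/\ w ^+ 2 + w + 1 = 0, 2 * c ^+ 3 = 1 + 2 * w
    & 2 * (- (3 * y + 1)%:R) * (1 + c) ^+ 3 = w].
Proof.
move=> nz; rewrite /norm_value.
have n2 : 2 != 0 :> K by exact: (nz 2%N).
have n3 : 3 != 0 :> K by exact: (nz 3%N).
have n7 : 7 != 0 :> K by exact: (nz 7%N).
have n17 : 17 != 0 :> K by exact: (nz 17%N).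
have n37 : 37 != 0 :> K by exact: (nz 37%N).
have -> : (3 * y + 1)%:R = 3 * y%:R + 1 :> K by ring.
have -> : (7 + 87 * y + 420 * y ^ 2 + 977 * y ^ 3 + 1122 * y ^ 4 + 681 * y ^ 5
    + 343 * y ^ 6)%:R = 7 + 87 * y%:R + 420 * y%:R ^+ 2 + 977 * y%:R ^+ 3
    + 1122 * y%:R ^+ 4 + 681 * y%:R ^+ 5 + 343 * y%:R ^+ 6 :> K by ring.
move: (y%:R : K) => x N0.
set X := - 3 - 18 * x - 27 * x ^+ 2 + x ^+ 3.
set Y := - 2 - 15 * x - 33 * x ^+ 2 - 18 * x ^+ 3.
have NXY : X ^+ 2 - X * Y + Y ^+ 2 = 0 by rewrite -[RHS]N0 /X /Y; ring.
(* Otherwise [X] and [Y] have a common root. Euclidean division of [X] by the two factors of [Y]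
   leaves -1 and [293 * x + 78]; the latter and the quadratic factor combine to 2 * 2 * 17 * 37,
   whence the primes 17 and 37. *)
have Y0 : Y != 0.
  apply/eqP => Y0; move: NXY; rewrite Y0 expr0n mulr0 subr0 addr0 /=.
  move/eqP; rewrite expf_eq0 /= => /eqP X0; move: Y0.
  have -> : Y = - (3 * x + 1) * (6 * x ^+ 2 + 9 * x + 2) by rewrite /Y; ring.
  move/eqP; rewrite mulf_eq0 oppr_eq0 => /orP[] /eqP e.
    have : 27 * X = - 1 + (3 * x + 1) * (9 * x ^+ 2 - 246 * x - 80) by rewrite /X; ring.
    rewrite X0 e mulr0 mul0r addr0 => /esym/eqP.
    by rewrite oppr_eq0 oner_eq0.
  have e2 : 293 * x + 78 = 0.
    transitivity (12 * X - (2 * x - 57) * (6 * x ^+ 2 + 9 * x + 2)); first by rewrite /X; ring.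
    by rewrite X0 e !mulr0 subr0.
  have e3 : 2 * 2 * 17 * 37 = 293 ^+ 2 * (6 * x ^+ 2 + 9 * x + 2)
      - (293 * x + 78) * (6 * 293 * x + 2169) :> K by ring.
  case/negP: (mulf_neq0 (mulf_neq0 (mulf_neq0 n2 n2) n17) n37).
  by rewrite e3 e e2 mulr0 mul0r subrr.
set w := - X / Y.
have wY : w * Y = - X by rewrite divfK.
have w1 : w ^+ 2 + w + 1 = 0.
  apply: (mulIf (expf_neq0 2 Y0)); rewrite mul0r -[RHS]NXY.
  have -> : (w ^+ 2 + w + 1) * Y ^+ 2 = (w * Y) ^+ 2 + (w * Y) * Y + Y ^+ 2 by ring.
  by rewrite wY; ring.
have n6 : 6 != 0 :> K by rewrite (natrM _ 2 3) mulf_neq0.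
have [|c [c1 c2]] := @cube_identities K w (- (3 * x + 1)) n6 n7 w1; last by exists w, c.
set m := - (3 * x + 1).
transitivity (27 * (X + w * Y) + (w ^+ 2 + w + 1) *
  ((8 * m ^+ 3 - 12 * m ^+ 2 + 6 * m - 1) * w + 28 * m ^+ 3 + 84 * m ^+ 2 + 3 * m + 1)).
  by rewrite /m /X /Y; ring.
by rewrite w1 mul0r addr0 wY subrr mulr0.
Qed.
Lemma in_gen_N1_6_expr p t (x : 'F_p) : (-1) ^+ t = 1 :> 'F_p -> 6 ^+ t = 1 :> 'F_p ->
  in_gen_N1_6 x -> x ^+ t = 1.
Proof.
move=> t1 t6 /imsetP[u /gen_prodgP[n [c cG ->]] ->] {x}.
have -> : val (\prod_(i < n) c i)%g = \prod_(i < n) val (c i).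
  by rewrite (big_morph val (@FinRing.val_unitM _) (FinRing.val_unit1 _)).
rewrite -prodrXl big1 // => i _.
by have := cG i; rewrite inE => /orP[]/eqP ->.
Qed.

Lemma natf_Fp_eq0 p n : prime p -> (n%:R == 0 :> 'F_p) = (p %| n)%N.
Proof. by move=> pr; rewrite (dvdn_pcharf (pchar_Fp pr)). Qed.

Lemma Fp_fermat p (x : 'F_p) : prime p -> x != 0 -> x ^+ p.-1 = 1.
Proof.
move=> pr x0; apply: (mulfI x0); rewrite mulr1 -exprS prednK ?prime_gt0 //.
by rewrite -{2}(expf_card x) card_Fp.
Qed.

(** With [t = (p - 1) / 3], raising to the power [t] is a cubic residue test. It sends -1 and 6 to
    1, hence also the subgroup they generate, but it sends 2 to [w ^+ t], which has order 3 because
    9 does not divide [p - 1]. Both 4 = 2^2 and 32 = 2^5 have exponents prime to 3. *)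
Lemma OP_primes_of_norm p y M : prime p -> (37 < p)%N -> (p %| norm_value y)%N ->
  (3 * y + 1 = M ^ 3)%N -> (p %% 9 != 1)%N -> OP_primes p.
Proof.
move=> pr p37 pN yM p9.
have nz q : (0 < q)%N -> (q < p)%N -> q%:R != 0 :> 'F_p.
  by move=> q0 qp; rewrite natf_Fp_eq0 // gtnNdvd.
have [||w [c [w1 c3 wc]]] := @cubic_pattern 'F_p y.
- move=> q; rewrite !inE => qs; apply: nz; move: qs.
    by do 4 (case/orP; first by move/eqP->); move/eqP->.
  by do 4 (case/orP; first by move/eqP->; apply: leq_trans p37); move/eqP->.
- by apply/eqP; rewrite natf_Fp_eq0.
have w3 : w ^+ 3 = 1.
  apply/eqP; rewrite -subr_eq0; have -> : w ^+ 3 - 1 = (w - 1) * (w ^+ 2 + w + 1) by ring.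
  by rewrite w1 mulr0.
have w0 : w != 0.
  by apply/eqP => w0; have /eqP := w3; rewrite w0 expr0n eq_sym oner_eq0.
have wn1 : w != 1.
  apply: contra_eq_neq w1 => ->; rewrite expr1n; have -> : 1 + 1 + 1 = 3 :> 'F_p by ring.
  by rewrite (nz 3%N) //; apply: leq_trans p37.
have wX i : (w ^+ i == 1) = (3 %| i)%N.
  rewrite {1}(divn_eq i 3) exprD mulnC exprM w3 expr1n mul1r /dvdn.
  have := ltn_pmod i (isT : 0 < 3)%N; case: (i %% 3)%N => [|[|[|]]] // _.
  - by rewrite expr1 (negbTE wn1).
  - apply/negbTE; apply: contra wn1 => /eqP w2.
    by rewrite -w3 exprS w2 mulr1.
have d3 : (3 %| p.-1)%N by rewrite -wX Fp_fermat.
set t := (p.-1 %/ 3)%N.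
have pt : p.-1 = (3 * t)%N by rewrite mulnC divnK.
have t3 : ~~ (3 %| t)%N.
  apply: contra p9 => /dvdnP[k tk]; rewrite -(prednK (prime_gt0 pr)) pt tk; apply/eqP; lia.
have cube1 x : x != 0 -> (x ^+ 3) ^+ t = 1 :> 'F_p.
  by move=> x0; rewrite -exprM -pt Fp_fermat.
have t2 : ~~ odd t.
  have := even_prime pr; case=> [p2|]; first by move: p37; rewrite p2.
  by rewrite -(prednK (prime_gt0 pr)) pt /= oddM.
have n1t : (-1) ^+ t = 1 :> 'F_p by rewrite -signr_odd (negbTE t2) expr0.
have n6t : 6 ^+ t = 1 :> 'F_p.
  have -> : 6 = (- 2 * c ^+ 2) ^+ 3 :> 'F_p.
    have -> : (- 2 * c ^+ 2) ^+ 3 = - 2 * (2 * c ^+ 3) ^+ 2 by ring.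
    rewrite c3; have -> : - 2 * (1 + 2 * w) ^+ 2 = 6 - 8 * (w ^+ 2 + w + 1) by ring.
    by rewrite w1 mulr0 subr0.
  apply: cube1; apply/eqP => e.
  have : (- 2 * c ^+ 2) * c = - (1 + 2 * w) by rewrite -c3; ring.
  rewrite e mul0r => /esym/eqP; rewrite oppr_eq0 => /eqP w2.
  have : 3 = 4 * (w ^+ 2 + w + 1) - (1 + 2 * w) ^+ 2 :> 'F_p by ring.
  rewrite w1 w2 mulr0 expr0n subr0 /= => /eqP.
  by rewrite (negbTE (nz 3%N _ _)) //; apply: leq_trans p37.
have n2t : 2 ^+ t = w ^+ t :> 'F_p.
  have e : 2 * (- (M%:R * (1 + c))) ^+ 3 = w.
    by rewrite -wc yM natrX; ring.
  rewrite -[in RHS]e exprMn cube1 ?mulr1 //.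
  by apply/eqP => e0; move: e; rewrite e0 expr0n mulr0 => /esym/eqP; rewrite (negbTE w0).
have n2i i : ~~ (3 %| i)%N -> ~~ in_gen_N1_6 ((2 ^ i)%:R : 'F_p).
  move=> i3; apply/negP => /(in_gen_N1_6_expr n1t n6t) /eqP.
  rewrite natrX exprAC n2t -exprM wX Euclid_dvdM //.
  by rewrite (negbTE i3) (negbTE t3).
split; rewrite ?(leq_trans _ p37) //.
  exact: (n2i 2%N).
exact: (n2i 5%N).
Qed.

(** The linear coefficient 87 is a multiple of 3, so at multiples of 3 only the constant term
    survives modulo 9. *)
Lemma norm_value_mod9 k : (norm_value (3 * k) %% 9 = 7)%N.
Proof.
have -> : norm_value (3 * k) = ((29 * k + k ^ 2 * (420 + 977 * (3 * k) + 1122 * (3 * k) ^ 2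
    + 681 * (3 * k) ^ 3 + 343 * (3 * k) ^ 4)) * 9 + 7)%N by rewrite /norm_value; ring.
by rewrite modnMDl.
Qed.

Lemma prime_divisors_mod1 d N : (0 < N)%N ->
  (forall p, prime p -> (p %| N)%N -> p = 1 %[mod d]) -> N = 1 %[mod d].
Proof.
have [n] := ubnP N; elim: n N => // n IH N Nn N0 h.
have [->//|N1] := eqVneq N 1%N.
have pr : prime (pdiv N) by apply: pdiv_prime; case: N N0 N1 {h Nn} => [|[]].
have /dvdnP[M NM] := pdiv_dvd N.
have M0 : (0 < M)%N by move: N0; rewrite NM muln_gt0 => /andP[].
rewrite NM -modnMm (h _ pr (pdiv_dvd N)) modnMm muln1; apply: IH => //.
  apply: leq_trans (Nn : (N <= n)%N); rewrite [in X in (_ < X)%N]NM -{1}[M]muln1.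
  by rewrite ltn_pmul2l // prime_gt1.
by move=> q qp qM; apply: h => //; rewrite NM dvdn_mulr.
Qed.

Lemma norm_value_coprime q y : prime q -> q != 3%N -> (q %| 3 * y + 1)%N ->
  ~~ (q %| norm_value y)%N.
Proof.
move=> pr q3 qM; apply/negP => qN.
have h : (3 * y + 1)%:R = 0 :> 'F_q by apply/eqP; rewrite natf_Fp_eq0.
have N0 : (norm_value y)%:R = 0 :> 'F_q by apply/eqP; rewrite natf_Fp_eq0.
(* This is the expansion in powers of [3 * y + 1]; the factor 3^6 clears the denominators, and the
   constant term is 1. *)
have : (27 * 27) * (norm_value y)%:R = 1 + (3 * y + 1)%:R * 
  (3 + 186 * (3 * y + 1)%:R - 443 * (3 * y + 1)%:R ^+ 2 + 5028 * (3 * y + 1)%:R ^+ 3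
    - 15 * (3 * y + 1)%:R ^+ 4 + 343 * (3 * y + 1)%:R ^+ 5) :> 'F_q.
  by rewrite /norm_value; ring.
rewrite {}h {}N0; move: (27 * 27) (_ - _ + _) => a b.
by rewrite mulr0 mul0r addr0 => /esym/eqP; rewrite oner_eq0.
Qed.

Lemma OP_primes_unbounded B : exists2 p, OP_primes p & (B < p)%N.
Proof.
pose n := maxn B 37.
pose P := (\prod_(q < n.+1 | prime q && (q != 3 :> nat)) q)%N.
have P3 : ~~ (3 %| P)%N.
  rewrite /P; elim/big_ind: _ => // [x y x3 y3|q /andP[pq q3]].
    by rewrite Euclid_dvdM // negb_or x3.
  by rewrite dvdn_prime2 // eq_sym.
have [j Mj] : exists j, (P ^ 2 = 3 * j + 1)%N.
  exists (P ^ 2 %/ 3)%N; rewrite {1}(divn_eq (P ^ 2) 3) mulnC -modnXm.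
  by move: P3; rewrite /dvdn; have := ltn_pmod P (isT : 0 < 3)%N; case: (P %% 3)%N => [|[|[|]]].
(* Chosen so that [y = 3 * k] gives [3 * y + 1 = (3 * j + 1) ^ 3]; that [y] is a multiple of 3
   yields the residue 7 modulo 9. *)
pose k := (3 * j ^ 3 + 3 * j ^ 2 + j)%N.
have yM : (3 * (3 * k) + 1 = (P ^ 2) ^ 3)%N by rewrite Mj /k; ring.
set N := norm_value (3 * k).
have N0 : (0 < N)%N by rewrite lt0n; apply: contra_eq_neq (norm_value_mod9 k) => e; rewrite -/N e.
have big p : prime p -> (p %| N)%N -> (n < p)%N.
  move=> pr pN; rewrite ltnNge; apply/negP => pn.
  have p3 : p != 3%N.
    apply/eqP => p3; move: pN; rewrite p3 /N /dvdn -(modn_dvdm _ (isT : 3 %| 9)%N).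
    by rewrite norm_value_mod9.
  have pP : (p %| P)%N.
    have pn1 : (p < n.+1)%N by [].
    by rewrite /P (bigD1 (Ordinal pn1)) /= ?pr ?p3 // dvdn_mulr.
  have := norm_value_coprime pr p3; move/(_ (3 * k)%N); rewrite yM -expnM.
  by rewrite Euclid_dvdX // pP -/N pN; move/(_ isT).
have [p [pr pN p9]] : exists p, [/\ prime p, (p %| N)%N & (p %% 9 != 1)%N].
  have [/hasP[p]|/hasPn h] := boolP (has (fun p => (p %% 9 != 1)%N) (primes N)).
    by rewrite mem_primes => /and3P[pr _ pN] p9; exists p.
  have := @prime_divisors_mod1 9 N N0; rewrite norm_value_mod9 => H.
  by suff: (7 = 1 %% 9)%N by []; apply: H => p pr pN; apply/eqP/negPn/h; rewrite mem_primes pr N0.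
exists p; last by apply: leq_ltn_trans (big p pr pN); rewrite leq_maxl.
apply: (OP_primes_of_norm pr _ pN yM p9).
by apply: leq_ltn_trans (big p pr pN); rewrite leq_maxr.
Qed.

Lemma OP_primes_infinite : infinite_set OP_primes.
Proof.
move=> /finite_seqP[s sE].
have [p Pp] := OP_primes_unbounded (\max_(q <- s) q).
have ps : p \in s by move: Pp; rewrite sE.
by rewrite ltnNge (leq_bigmax_seq _ ps).
Qed.

Local Close Scope ring_scope.

(** * Tiling the differences by multiples of {1, 2, 3} and {1, 2, 3, 4} *)

(** Each left coset of the group generated by [t] gets [repr] as its origin, and [e x] is the
    exponent of [t] leading from there to [x]. *)
Lemma cyclic_labelling (gT : finGroupType) (t : gT) :
  exists e : gT -> nat, forall x, e x < #[t]%g /\ e (x * t)%g = (e x).+1 %[mod #[t]%g].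
Proof.
pose r x := repr (x *: <[t]>)%g.
have ex x : exists i : 'I_#[t]%g, (r x * t ^+ i == x)%g.
  have : r x \in (x *: <[t]>)%g by apply: mem_repr (lcoset_refl _ _).
  rewrite mem_lcoset -groupV invMg invgK => /cyclePmin[i it e].
  by exists (Ordinal it); rewrite /= -e mulKVg.
exists (fun x => nat_of_ord (xchoose (ex x))) => x; split; first exact: ltn_ord.
apply/eqP; rewrite -eq_expg_mod_order.
move: (xchooseP (ex x)) (xchooseP (ex (x * t)%g)).
move: (xchoose (ex x)) (xchoose (ex (x * t)%g)) => i j.
have -> : r (x * t)%g = r x by rewrite /r lcosetM lcoset_id ?cycle_id.
move=> /eqP e1 /eqP e2; apply/eqP; apply: (mulgI (r x)).
by rewrite e2 expgSr mulgA e1.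
Qed.

(* One more than the exponent of 2 in [d] modulo -1 and 6; note 3 = 6 / 2. *)
Definition exponent_class (d : nat) : nat := nth 0 [:: 0; 1; 2; 0; 3] d.

(** [o] is the order of 2 modulo -1 and 6, so the hypotheses on 4 and 32 say that it divides neither
    2 nor 5. The successor on the left offsets the one in [exponent_class], which keeps the exponent
    -1 of 3 within the naturals. *)
Lemma two_labelling p : OP_primes p -> exists2 o, (0 < o) && (o \notin [:: 1; 2; 5]) &
  exists E : 'F_p -> nat, [/\ forall x, E x < o, forall x, x != 0%R -> E (- x)%R = E x
    & forall x d, x != 0%R -> 0 < d < 5 -> (E (x * d%:R)%R).+1 = E x + exponent_class d %[mod o]].
Proof.
case=> pr p7 n4 n32.
pose H := <<gens_N1_6 p>>%g.
have mulC (u v : {unit 'F_p}) : (u * v = v * u)%g.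
  by apply: val_inj; rewrite !FinRing.val_unitM mulrC.
have nH u : u \in 'N(H)%g.
  apply/normP/setP => v; rewrite mem_conjg /conjg invgK.
  by rewrite [(v * _)%g]mulC mulKVg.
pose un (x : 'F_p) : {unit 'F_p} := insubd (1%g : {unit 'F_p}) x.
have unK x : x != 0%R -> val (un x) = x.
  by move=> x0; rewrite insubdK // -topredE /= unitfE.
have unM x y : x != 0%R -> y != 0%R -> un (x * y)%R = (un x * un y)%g.
  by move=> x0 y0; apply: val_inj; rewrite FinRing.val_unitM !unK ?mulf_neq0.
have nz d : 0 < d -> d < p -> d%:R%R != 0%R :> 'F_p.
  by move=> d0 dp; rewrite natf_Fp_eq0 // gtnNdvd.
have n2 : 2%:R%R != 0%R :> 'F_p by apply: nz; lia.
pose q x := coset H (un x).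
have qM x y : x != 0%R -> y != 0%R -> q (x * y)%R = (q x * q y)%g.
  by move=> x0 y0; rewrite /q unM // morphM.
have q1 x : x != 0%R -> (x == -1)%R || (x == 6%:R)%R -> q x = 1%g.
  by move=> x0 hx; apply: coset_id; apply: mem_gen; rewrite inE unK.
pose t := q 2%:R%R.
have inH x : x != 0%R -> q x = 1%g -> in_gen_N1_6 x.
  by move=> x0 qx; apply/imsetP; exists (un x); rewrite ?unK //; apply: coset_idr.
have qX n : q (2%:R ^+ n)%R = (t ^+ n)%g.
  elim: n => [|n IH]; last by rewrite exprS qM ?expf_neq0 // IH expgS.
  rewrite expr0 expg0 /q; have -> : un 1%R = 1%g by apply: val_inj; rewrite unK ?oner_neq0.
  by rewrite coset_id ?group1.
have [e he] := cyclic_labelling t.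
exists #[t]%g.
  rewrite order_gt0 !inE /= !negb_or; apply/and3P.
  have h n : ~~ in_gen_N1_6 ((2 ^ n)%:R : 'F_p)%R -> ~~ (#[t]%g %| n).
    apply: contra => tn; apply: inH; first by rewrite natrX expf_neq0.
    by rewrite natrX qX; apply/eqP; rewrite -order_dvdn.
  have h2 := h 2 n4; have h5 := h 5 n32.
  by split; apply/eqP => o1; move: h2 h5; rewrite o1.
exists (fun x => e (q x)); split=> [x|x x0|x d x0 d5].
- exact: (he _).1.
- rewrite -mulN1r qM ?oppr_eq0 ?oner_neq0 // q1 ?eqxx ?oppr_eq0 ?oner_neq0 //.
  by rewrite mul1g.
have step y : y != 0%R -> e (q (y * 2%:R)%R) = (e (q y)).+1 %[mod #[t]%g].
  by move=> y0; rewrite qM //; exact: (he _).2.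
have q6 y : y != 0%R -> q (y * 6%:R)%R = q y.
  have n6 : 6%:R%R != 0%R :> 'F_p by apply: nz; lia.
  by move=> y0; rewrite qM // [q 6%:R%R]q1 ?mulg1 // eqxx orbT.
have d14 : d \in [:: 1; 2; 3; 4] by rewrite !inE; lia.
move: d14; rewrite !inE => /or4P[]/eqP->; rewrite /exponent_class /=.
- by rewrite mulr1 addn1.
- by rewrite -addn1 -modnDml step // modnDml; congr (_ %% _); lia.
- have n3 : 3%:R%R != 0%R :> 'F_p by apply: nz; lia.
  by rewrite -step ?mulf_neq0 // -mulrA -natrM q6 // addn0.
- rewrite (natrM _ 2 2) mulrA -addn1 -modnDml step ?mulf_neq0 // modnDml -addn1.
  rewrite -addnA -modnDml step // modnDml; congr (_ %% _); lia.
Qed.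

(* The exponents below [o] are cut into [o %% 3] intervals of length 4, followed by
   intervals of length 3; [tile_start o s] is the tile beginning at [s], if any. *)
Definition tile_start o s : seq nat :=
  if s < 4 * (o %% 3) then (if 4 %| s then [:: 1; 2; 3; 4] else [::])
  else if 3 %| s - 4 * (o %% 3) then [:: 1; 2; 3] else [::].

Lemma tile_start_unique o s s' d d' :
  d \in tile_start o s -> d' \in tile_start o s' ->
  s + exponent_class d = s' + exponent_class d' -> d = d'.
Proof.
have tP r k : k \in tile_start o r -> (k \in [:: 1; 2; 3; 4]) /\
    (if r < 4 * (o %% 3) then (4 %| r) && (exponent_class k < 4)
     else (3 %| r - 4 * (o %% 3)) && (exponent_class k < 3)).
  rewrite /tile_start; case: ifP => h1; case: ifP => // h2; rewrite !inE.
    by case/or4P => /eqP ->.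
  by case/or3P => /eqP ->.
move=> /tP[d4 h] /tP[d4' h'] e.
have {h h'} ee : exponent_class d = exponent_class d'.
  move: h h' e; move: (o %% 3) (exponent_class d) (exponent_class d') => b x x'.
  by case: ifP => h1; case: ifP => h2 /andP[h3 h4] /andP[h5 h6]; lia.
move: d4 d4' ee; rewrite !inE => /or4P[]/eqP-> /or4P[]/eqP->; by [].
Qed.

(** Since 3 has exponent -1, the multiples of [g] cover the tile starting at [E g - 1]. The exponent
    of [u] determines its tile and [d], hence [g] up to sign, and [pos] picks one of [g] and
    [- g]. *)
Lemma tiling p : OP_primes p -> exists tau : 'F_p -> seq nat,
  [/\ forall g, tau g \in [:: [::]; [:: 1; 2; 3]; [:: 1; 2; 3; 4]],
    forall g d, d \in tau g -> g != 0%R & forall u : 'F_p, u != 0%R -> exists g d,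
    [/\ d \in tau g, u = (g * d%:R)%R \/ u = (- (g * d%:R))%R
      & forall g' d', d' \in tau g' -> u = (g' * d'%:R)%R \/ u = (- (g' * d'%:R))%R ->
          g' = g /\ d' = d]].
Proof.
move=> Pp; have [pr p7 _ _] := Pp.
have [o /andP[o0 o125] [E [Eo EN Emul]]] := two_labelling Pp.
pose pos (g : 'F_p) := val g < val (- g)%R.
pose tau g := if pos g && (0 < E g) then tile_start o (E g).-1 else [::].
(* The only positive [o] violating this are 1, 2 and 5. *)
have b4o : 4 * (o %% 3) <= o by move: o125; rewrite !inE; lia.
have posN g : pos g -> ~~ pos (- g)%R by rewrite /pos opprK -leqNgt => /ltnW.
have pos_or g : g != 0%R -> pos g || pos (- g)%R.
  move=> g0; rewrite /pos opprK -neq_ltn; apply/eqP => /val_inj gg.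
  have : (g * 2%:R == 0)%R by rewrite mulr2n mulrDr mulr1 {2}gg subrr.
  by rewrite mulf_eq0 (negbTE g0) natf_Fp_eq0 //= gtnNdvd //; lia.
have nz d : 0 < d < 5 -> d%:R%R != 0%R :> 'F_p.
  by move=> d5; rewrite natf_Fp_eq0 // gtnNdvd; lia.
have tauE g d : d \in tau g -> [/\ g != 0%R, pos g, 0 < d < 5, 0 < E g &
    (d \in tile_start o (E g).-1) && ((E g).-1 + exponent_class d < o)].
  rewrite /tau; case: ifP => // /andP[pg Eg] dt; split=> //.
  - by apply: contraTneq pg => ->; rewrite /pos oppr0 ltnn.
  - move: dt; rewrite /tile_start; case: ifP => _; case: ifP => // _; rewrite !inE; lia.
  - rewrite dt /=; move: dt (Eo g); rewrite /tile_start /exponent_class.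
    case: ifP => h; case: ifP => // h'; rewrite !inE.
      by case/or4P => /eqP -> /=; lia.
    by case/or3P => /eqP -> /=; lia.
have Etau g d u : d \in tau g -> u = (g * d%:R)%R \/ u = (- (g * d%:R))%R ->
    E u = (E g).-1 + exponent_class d.
  case/tauE => g0 _ d5 Eg /andP[_ lo] hu.
  have {hu} Eu : E u = E (g * d%:R)%R.
    by case: hu => -> //; rewrite EN // mulf_neq0 ?nz.
  have := Emul g d g0 d5; rewrite -Eu -{1}(prednK Eg) addSn -addn1 -[in RHS]addn1.
  move/eqP; rewrite eqn_modDr => /eqP; rewrite !modn_small //.
have tileP j : j < o -> exists s d,
    [/\ d \in tile_start o s, 0 < d < 5, j = s + exponent_class d & s.+1 < o].
  move=> jo; rewrite /tile_start; case: (ltnP j (4 * (o %% 3))) => jb.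
    (* The list inverts [exponent_class]: the offsets 0, 1, 2, 3 in a tile belong to the multiples
       by 3, 1, 2, 4. *)
    exists (j - j %% 4), (nth 0 [:: 3; 1; 2; 4] (j %% 4)).
    have -> : j - j %% 4 < 4 * (o %% 3) by lia.
    have -> : 4 %| j - j %% 4 by lia.
    have h4 : j %% 4 < 4 by rewrite ltn_mod.
    have hj : j - j %% 4 + 3 < o by lia.
    move: h4 (leq_mod j 4) hj.
    by case: (j %% 4) => [|[|[|[|]]]] //= _ h hj; rewrite !inE /exponent_class /=; split=> //; lia.
  exists (j - (j - 4 * (o %% 3)) %% 3), (nth 0 [:: 3; 1; 2] ((j - 4 * (o %% 3)) %% 3)).
  have -> : (j - (j - 4 * (o %% 3)) %% 3 < 4 * (o %% 3)) = false by lia.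
  have -> : 3 %| j - (j - 4 * (o %% 3)) %% 3 - 4 * (o %% 3) by lia.
  have h3 : (j - 4 * (o %% 3)) %% 3 < 3 by rewrite ltn_mod.
  have hj : j - (j - 4 * (o %% 3)) %% 3 + 2 < o by lia.
  move: h3 (leq_mod (j - 4 * (o %% 3)) 3) hj.
  by case: (_ %% 3) => [|[|[|]]] //= _ h hj; rewrite !inE /exponent_class /=; split=> //; lia.
exists tau; split=> [g|g d /tauE[]//|u u0].
  by rewrite /tau /tile_start; do 4 case: ifP => //=.
have [s [d [ds d5 Es so]]] := tileP _ (Eo u).
have [g [pg g0 ug]] : exists g, [/\ pos g, g != 0%R & u = (g * d%:R)%R \/ u = (- (g * d%:R))%R].
  have g0 : (u / d%:R)%R != 0%R by rewrite mulf_neq0 ?invr_eq0 ?nz.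
  case/orP: (pos_or _ g0) => pg; [exists (u / d%:R)%R | exists (- (u / d%:R))%R];
    rewrite ?oppr_eq0 ?mulNr ?opprK ?divfK ?nz //; split=> //; [by left | by right].
have Eg : E g = s.+1.
  have Eu : E u = E (g * d%:R)%R.
    by case: ug => -> //; rewrite EN // mulf_neq0 ?nz.
  have := Emul g d g0 d5; rewrite -Eu Es -addSn => /eqP.
  by rewrite eqn_modDr !modn_small // => /eqP.
exists g, d; split=> // [|g' d' dt' ug'].
  by rewrite /tau pg Eg.
have dt : d \in tau g by rewrite /tau pg Eg.
have Eg' := Etau _ _ _ dt' ug'; have Ed := Etau _ _ _ dt ug.
have [g0' pg' d5' Egp' /andP[dts' lo']] := tauE _ _ dt'.
have dd : d' = d.
  by apply: esym; apply: tile_start_unique ds dts' _; rewrite -Es.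
split=> //; move: ug ug'; rewrite dd.
have inj (x y : 'F_p) : (x * d%:R = y * d%:R)%R -> x = y by move/(mulIf (nz d d5)).
case=> -> [] e.
- exact/esym/inj.
- by have := posN _ pg'; rewrite -(inj g (- g')%R) ?pg // mulNr.
- by have := posN _ pg'; rewrite -(inj g (- g')%R) ?pg // mulNr -e opprK.
- by apply/esym/inj/oppr_inj.
Qed.

(** * Assembling the factorisation *)

Section ReductionModP.

Variables (p : nat) (K : nat) (S : seq nat) (D : seq (nat * nat)) (B : nat -> seq nat).
Variables (P : nat -> seq (seq nat)) (L : seq nat).
Hypotheses (pr : prime p) (uS : uniq S) (blk : is_block K S D B P p L).

Let red (i : nat) : 'F_p := (i%:R)%R.
Let red_edge (e : nat * nat) := (red e.1, e.2).

Lemma red_addp i : red (p + i) = red i.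
Proof. by rewrite /red natrD pchar_Fp_0 ?add0r. Qed.

Lemma red_inj : {in gtn p &, injective red}.
Proof.
move=> i j ip jp /(congr1 val).
by rewrite /red /= !val_Fp_nat // !modn_small.
Qed.

Lemma red_surj (x : 'F_p) : exists2 i, i < p & red i = x.
Proof.
exists (val x); last by rewrite /red natr_Zp.
by rewrite -[X in _ < X](Fp_cast pr) ltn_ord.
Qed.

(** Modulo p the boundary [B c] and its translate by p are equal and cancel, so each colour spans
    all residues exactly once. *)
Lemma block_vertices c : c < K ->
  uniq (map red (flatten (P c))) /\ forall x, x \in map red (flatten (P c)).
Proof.
move=> cK; have /and3P[/allP/(_ c) h _ _] := blk.
have {h} : perm_eq (map red (flatten (P c))) (map red (iota 0 p)).
  have := perm_map red (h _); rewrite mem_iota cK !map_cat => /(_ isT).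
  have -> : map red (map (addn p) (B c)) = map red (B c).
    by rewrite -map_comp; apply: eq_map => i; apply: red_addp.
  by rewrite perm_cat2r.
move=> pe; split.
  rewrite (perm_uniq pe) map_inj_in_uniq ?iota_uniq // => i j.
  by rewrite !mem_iota => ip jp; apply: red_inj.
move=> x; rewrite (perm_mem pe); have [i ip <-] := red_surj x.
by apply: map_f; rewrite mem_iota.
Qed.

Lemma block_edges :
  uniq (map red_edge (flatten [seq edges_of (P c) | c <- iota 0 K])) /\
  forall i d, ((i, d) \in map red_edge (flatten [seq edges_of (P c) | c <- iota 0 K])) = (d \in S).
Proof.
have /and3P[_ h _] := blk.
have {h} : perm_eq (map red_edge (flatten [seq edges_of (P c) | c <- iota 0 K]))
                   (map red_edge (strip S p)).
  have := perm_map red_edge h; rewrite !map_cat.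
  have -> : map red_edge (eshift p D) = map red_edge D.
    by rewrite /eshift -map_comp; apply: eq_map => e; rewrite /red_edge /= red_addp.
  by rewrite perm_cat2r.
move=> pe; split=> [|i d].
  rewrite (perm_uniq pe) map_inj_in_uniq; first last.
    move=> e e' /allpairsP[[i d] [/= ip _ ->]] /allpairsP[[j d'] [/= jp _ ->]].
    move: ip jp; rewrite !mem_iota /red_edge /= => ip jp [e1 ->].
    by rewrite (red_inj ip jp e1).
  by apply: allpairs_uniq; rewrite ?iota_uniq // => -[i d] [j d'] _ _ /=.
rewrite (perm_mem pe); apply/mapP/idP.
  by case=> e /allpairsP[[j d'] [/= _ dS ->]] [_ ->].
move=> dS; have [j jp <-] := red_surj i.
by exists (j, d) => //; apply/allpairsP; exists (j, d); rewrite mem_iota.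
Qed.

Lemma block_edge_colour i d : d \in S ->
  exists2 c, c < K & (i, d) \in map red_edge (edges_of (P c)).
Proof.
rewrite -(block_edges.2 i) => /mapP[e /flattenP[E /mapP[c]]].
rewrite mem_iota => /= cK -> eP ->; exists c => //; exact: map_f.
Qed.

Lemma block_edge_unique i d c c' : c < K -> c' < K ->
  (i, d) \in map red_edge (edges_of (P c)) ->
  (i, d) \in map red_edge (edges_of (P c')) -> c = c'.
Proof.
move=> cK cK' h h'; have := block_edges.1.
have : c \in iota 0 K by rewrite mem_iota.
have : c' \in iota 0 K by rewrite mem_iota.
elim: (iota 0 K) => //= a s IH; rewrite map_cat cat_uniq !inE.
have out b : b \in s -> (i, d) \in map red_edge (edges_of (P b)) ->
    (i, d) \in map red_edge (flatten [seq edges_of (P c) | c <- s]).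
  move=> bs /mapP[e eb ->]; apply: map_f; apply/flattenP.
  by exists (edges_of (P b)) => //; apply: map_f.
move=> c's cs /and3P[_ /hasPn dis us].
case/orP: cs => [/eqP e|cs]; case/orP: c's => [/eqP e'|c's].
- by rewrite e e'.
- by have := dis _ (out _ c's h'); rewrite -e h.
- by have := dis _ (out _ cs h); rewrite -e' h'.
- exact: IH.
Qed.

Lemma block_edge_length i d c : c < K -> (i, d) \in map red_edge (edges_of (P c)) -> d \in S.
Proof.
move=> cK /mapP[e eP ed]; rewrite -(block_edges.2 i) ed; apply: map_f.
by apply/flattenP; exists (edges_of (P c)) => //; apply: map_f; rewrite mem_iota.
Qed.

Lemma scaled_adjP (g : 'F_p) c x y :
  reflect (exists i d, (i, d) \in map red_edge (edges_of (P c)) /\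
             ((x = g * i /\ y = g * (i + d%:R)) \/ (y = g * i /\ x = g * (i + d%:R)))%R)
    (cycle_adj (map (map (fun i => g * red i)%R) (P c)) x y).
Proof.
pose f i := (g * red i)%R.
have pairs : flatten (map (@cycle_pairs _) (map (map f) (P c))) =
    map (fun e => (f e.1, f e.2)) (flatten (map (@cycle_pairs _) (P c))).
  rewrite map_flatten -!map_comp; congr flatten; apply: eq_map => s /=.
  exact: map_cycle_pairs.
have edges : edges_of (P c) = map edge_of (flatten (map (@cycle_pairs _) (P c))).
  by rewrite /edges_of map_flatten -map_comp.
have fE a b : f (minn a b) = (g * red (minn a b))%R /\
    f (maxn a b) = (g * (red (minn a b) + (maxn a b - minn a b)%:R))%R.
  by split; rewrite // /f /red -natrD subnKC // geq_min leq_max leqnn.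
rewrite /cycle_adj -/f pairs edges; apply: (iffP orP).
  have aux a b : (a, b) \in flatten (map (@cycle_pairs _) (P c)) ->
      exists i d, (i, d) \in map red_edge (map edge_of (flatten (map (@cycle_pairs _) (P c)))) /\
        ((f a = g * i /\ f b = g * (i + d%:R)) \/ (f b = g * i /\ f a = g * (i + d%:R)))%R.
    move=> ab; exists (red (minn a b)), (maxn a b - minn a b); split.
      by apply/mapP; exists (edge_of (a, b)) => //; apply: map_f.
    have [fm fM] := fE a b; case: (leqP a b) fm fM => h _ <-; [left | right]; split=> //.
  case=> /mapP[[a b] /aux[i [d [id h]]]] [-> ->]; exists i, d; split=> //.
  by case: h; [right|left].
case=> i [d [/mapP[e /mapP[[a b] ab ->] [-> ->]] h]]; rewrite /edge_of /= in h.
have [fm fM] := fE a b.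
have {}h : (x, y) = (f (minn a b), f (maxn a b)) \/ (y, x) = (f (minn a b), f (maxn a b)).
  by case: h => -[-> ->]; rewrite -fM; [left|right].
have {}h : (x, y) = (f a, f b) \/ (y, x) = (f a, f b).
  by case: (leqP a b) h => hab [] [-> ->]; auto.
by case: h => ->; [left|right]; apply/mapP; exists (a, b).
Qed.

End ReductionModP.

Lemma cycle_adj_sym (T : eqType) (ss : seq (seq T)) : symmetric (cycle_adj ss).
Proof. by move=> x y; rewrite /cycle_adj /= orbC. Qed.

Section GraphOf.

Variables (T : finType) (ss : seq (seq T)).

Definition graph_rel : rel T := fun x y => (x != y) && cycle_adj ss x y.

Lemma graph_rel_sym : symmetric graph_rel.
Proof. by move=> x y; rewrite /graph_rel eq_sym cycle_adj_sym. Qed.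

Lemma graph_rel_irr : irreflexive graph_rel.
Proof. by move=> x; rewrite /graph_rel eqxx. Qed.

Definition graph_of : sgraph T := SGraph graph_rel_sym graph_rel_irr.

End GraphOf.

(** Reduces the problem to lists of cycles on any set of the right size: all have the shape of [F],
    and each pair of distinct points is adjacent in exactly one of them. *)
Lemma factorisation_of_presentations (T V : finType) (F : sgraph V) ss
    (I : finType) (tt : I -> seq (seq T)) (x0 : T) (y0 : V) :
  #|T| = #|V| ->
  uniq (flatten ss) -> (forall x, x \in flatten ss) -> F =2 cycle_adj ss ->
  (forall i, [/\ uniq (flatten (tt i)), forall x, x \in flatten (tt i)
     & perm_eq (map size (tt i)) (map size ss)]) ->
  (forall i x, ~~ cycle_adj (tt i) x x) ->
  (forall x y, x != y -> exists i, cycle_adj (tt i) x y) ->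
  (forall x y i j, x != y -> cycle_adj (tt i) x y -> cycle_adj (tt j) x y -> i = j) ->
  OP_solvable F.
Proof.
move=> cTV us ess Fss tP tirr tex tun.
pose h (x : T) : 'I_#|V| := cast_ord cTV (enum_rank x).
pose h' (k : 'I_#|V|) : T := enum_val (cast_ord (esym cTV) k).
have hK : cancel h h' by move=> x; rewrite /h /h' cast_ordK enum_rankK.
have h'K : cancel h' h by move=> x; rewrite /h /h' enum_valK cast_ordKV.
have hi := can_inj hK.
have adjh i x y : cycle_adj (map (map h) (tt i)) x y = cycle_adj (tt i) (h' x) (h' y).
  by rewrite -{1}[x]h'K -{1}[y]h'K cycle_adj_map.
exists #|I|, (fun k => graph_of (map (map h) (tt (enum_val k)))); split.
  split.
  - by move=> i x y /andP[].
  - move=> i j ij x y; apply/negP => /andP[/andP[xy ai] /andP[_ aj]].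
    case/negP: ij; apply/eqP/enum_val_inj.
    have xy' : h' x != h' y by rewrite (can_eq h'K).
    by apply: tun xy' _ _; rewrite -adjh.
  - move=> x y xy; have xy' : h' x != h' y by rewrite (can_eq h'K).
    have [i ai] := tex _ _ xy'; exists (enum_rank i).
    by rewrite /= /graph_rel enum_rankK adjh ai andbT.
move=> k; set i := enum_val k.
have [ut et st] := tP i.
apply: (same_shape_isomorphic (ss := map (map h) (tt i)) (tt := ss) (h x0) y0) => //.
- by rewrite -map_flatten map_inj_uniq.
- by move=> x; rewrite -map_flatten -[x]h'K map_f.
- move=> x y /=; rewrite /graph_rel; case: eqVneq => [->|//] /=.
  by rewrite adjh (negbTE (tirr _ _)).
rewrite -map_comp (eq_map (g := size)) // => c /=; by rewrite size_map.
Qed.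

Lemma OP_solvable_of_OP_prime p (V : finType) (F : sgraph V) :
  OP_primes p -> #|V| = p -> regular F 2 ->
  num_cycles F 3 <= num_cycles F 5 + \sum_(7 <= i < p.+1) num_cycles F i ->
  OP_solvable F.
Proof.
move=> Pp cV F2; have [pr p7 _ _] := Pp; rewrite -cV => hF.
have [ss [us ess hss Fss]] := two_regular_cycles F2.
have aL := cycles_admissible F2 us ess hss hF.
have sL : sumn (map size ss) = p.
  by rewrite -cV -(size_flatten ss) -(card_uniqP us); apply: eq_card => x; rewrite ess inE.
have [P3 bP3] := admissible_has_block3 aL.
have [||P4 bP4] := admissible_has_block4 aL; rewrite ?sL.
- by case: (even_prime pr) p7 => // ->.
- by apply/eqP => p9; move: pr; rewrite p9.
rewrite sL in bP3 bP4.
have [tau [tauS tau0 tauP]] := tiling Pp.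
pose P g := if size (tau g) == 3 then P3 else P4.
have blk g : tau g != [::] -> exists D B,
    is_block (size (tau g)) (tau g) D B (P g) p (map size ss).
  have := tauS g; rewrite !inE /P => /or3P[] /eqP -> // _.
    by do 2 eexists; exact: bP3.
  by do 2 eexists; exact: bP4.
have tau_ne g (c : nat) : c < size (tau g) -> tau g != [::] by case: (tau g).
have tau_uniq g : uniq (tau g).
  by have := tauS g; rewrite !inE => /or3P[] /eqP ->.
(* A factor is given by a multiplier and a colour; a connection set with K lengths has K colours,
   and an empty [tau g] contributes no factor. *)
pose I := {x : 'F_p * 'I_4 | x.2 < size (tau x.1)}.
pose tt (i : I) : seq (seq 'F_p) := map (map (fun k => (val i).1 * k%:R)%R) (P (val i).1 (val i).2).
have adj_tau (i : I) (x y : 'F_p) : cycle_adj (tt i) x y -> exists j d,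
    [/\ (j, d) \in map (fun e => (e.1%:R%R : 'F_p, e.2)) (edges_of (P (val i).1 (val i).2)),
        d \in tau (val i).1 &
        ((x = (val i).1 * j /\ y = (val i).1 * (j + d%:R)) \/
         (y = (val i).1 * j /\ x = (val i).1 * (j + d%:R)))%R].
  have [D [B b]] := blk _ (tau_ne _ _ (valP i)).
  move=> /scaled_adjP[j [d [jd h]]]; exists j, d; split=> //.
  exact: (block_edge_length pr (tau_uniq _) b (valP i) jd).
have diff_tau (i : I) (x y : 'F_p) : cycle_adj (tt i) x y -> exists d, d \in tau (val i).1 /\
    ((y - x = (val i).1 * d%:R) \/ (y - x = - ((val i).1 * d%:R)))%R.
  case/adj_tau=> j [d [_ dt h]]; exists d; split=> //.
  by case: h => -[-> ->]; [left|right]; ring.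
have n0 d : 0 < d < 5 -> d%:R%R != 0%R :> 'F_p.
  by move=> d5; rewrite natf_Fp_eq0 // gtnNdvd; lia.
have tau15 g d : d \in tau g -> 0 < d < 5.
  have := tauS g; rewrite !inE => /or3P[] /eqP -> //; rewrite !inE; lia.
have c0 : #|'F_p| = #|V| by rewrite card_Fp.
have /card_gt0P[y0 _] : 0 < #|V| by rewrite cV prime_gt0.
apply: (factorisation_of_presentations (tt := tt) 0%R y0 c0 us ess Fss).
- move=> i; have g0 : (val i).1 != 0%R.
    have := tau_ne _ _ (valP i); case E: (tau (val i).1) => [|d t] // _.
    by apply: (tau0 _ d); rewrite E mem_head.
  have [D [B b]] := blk _ (tau_ne _ _ (valP i)).
  have [uv ev] := block_vertices pr b (valP i).
  have fl : flatten (tt i) = map (fun x => (val i).1 * x)%R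
      (map (fun k => k%:R : 'F_p)%R (flatten (P (val i).1 (val i).2))).
    by rewrite /tt -map_flatten -map_comp.
  split.
  + by rewrite fl map_inj_uniq //; apply: mulfI.
  + by move=> x; rewrite fl -[x](mulVKf g0) map_f.
  + rewrite /tt -map_comp (eq_map (g := size)) => [|s /=]; last by rewrite size_map.
    by have /and3P[_ _ /allP/(_ (val i).2)] := b; rewrite mem_iota; apply; exact: (valP i).
- move=> i x; apply/negP => /diff_tau[d [dt]].
  have : ((val i).1 * d%:R)%R != 0%R by rewrite mulf_neq0 ?n0 ?(tau15 _ _ dt) ?(tau0 _ _ dt).
  by move=> h0; rewrite subrr => -[] /esym/eqP; rewrite ?oppr_eq0 (negbTE h0).
- move=> x y xy.
  have u0 : (y - x)%R != 0%R by rewrite subr_eq0 eq_sym.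
  have [g [d [dt hu _]]] := tauP _ u0.
  have g0 := tau0 _ _ dt.
  have tg : tau g != [::] by case: (tau g) dt.
  have [D [B b]] := blk _ tg.
  have find z : exists2 i : I, (val i).1 = g &
      (z, d) \in map (fun e => (e.1%:R%R : 'F_p, e.2)) (edges_of (P g (val i).2)).
    have [c cg zd] := block_edge_colour pr (tau_uniq g) b z dt.
    have c4 : c < 4.
      by apply: leq_trans cg _; have := tauS g; rewrite !inE => /or3P[] /eqP ->.
    by exists (exist _ (g, Ordinal c4) cg).
  (* The sign of the difference decides which of [x] and [y] is the lower end of the scaled edge. *)
  case: hu => [xy'|/(congr1 (fun a => - a)%R)]; last rewrite /= opprK opprB => xy'.
    have [i ig zd] := find (x / g)%R; exists i; apply/scaled_adjP; rewrite ig.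
    by exists (x / g)%R, d; split=> //; left; rewrite mulrDr -xy' mulrC divfK // subrKC.
  have [i ig zd] := find (y / g)%R; exists i; apply/scaled_adjP; rewrite ig.
  by exists (y / g)%R, d; split=> //; right; rewrite mulrDr -xy' mulrC divfK // subrKC.
- move=> x y i j xy ai aj.
  have u0 : (y - x)%R != 0%R by rewrite subr_eq0 eq_sym.
  have [g [d [dt hu un]]] := tauP _ u0.
  have g0 := tau0 _ _ dt.
  have tag (k : I) : cycle_adj (tt k) x y -> (val k).1 = g /\ exists z,
      (z, d) \in map (fun e => (e.1%:R%R : 'F_p, e.2)) (edges_of (P g (val k).2)) /\
      ((x = g * z /\ y = g * (z + d%:R)) \/ (y = g * z /\ x = g * (z + d%:R)))%R.
    case/adj_tau=> z [d' [zd dt' h]].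
    have [|kg dd] := un _ _ dt'.
      by case: h => -[-> ->]; [left|right]; ring.
    by rewrite -kg -dd; split=> //; exists z.
  have [ig [z [zi hz]]] := tag i ai; have [jg [z' [zj hz']]] := tag j aj.
  have tg : tau g != [::] by case: (tau g) dt.
  have [D [B b]] := blk _ tg.
  have d2 : (2%:R * d%:R)%R != 0%R :> 'F_p by rewrite mulf_neq0 ?n0 ?(tau15 _ _ dt).
  (* An edge cannot be recorded from both of its ends with the same length [d], for then [2 * d]
     would vanish. *)
  have opposite (a a' : 'F_p) : (g * a = g * (a' + d%:R) -> g * a' = g * (a + d%:R) -> False)%R.
    move=> /(mulfI g0) e /(mulfI g0) e'; case/eqP: d2.
    by apply: (@addrI _ a); rewrite addr0 [in RHS]e e'; ring.
  have zz : z = z'.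
    case: hz hz' => -[ex ey] [] [ex' ey'].
    - by apply: (mulfI g0); rewrite -ex -ex'.
    - by case: (opposite z z'); [rewrite -ex -ey' | rewrite -ex' -ey].
    - by case: (opposite z z'); [rewrite -ex -ey' | rewrite -ex' -ey].
    - by apply: (mulfI g0); rewrite -ex -ex'.
  have ci : (val i).2 < size (tau g) by rewrite -ig; exact: (valP i).
  have cj : (val j).2 < size (tau g) by rewrite -jg; exact: (valP j).
  have cc : val (val i).2 = val (val j).2.
    by apply: (block_edge_unique pr (tau_uniq g) b ci cj zi); rewrite zz.
  by apply: val_inj; rewrite [val i]surjective_pairing [val j]surjective_pairing ig jg (val_inj cc).
Qed.

Theorem theorem27 :
  infinite_set OP_primes /\
  (forall p : nat, OP_primes p ->
   forall (V : finType) (F : sgraph V),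
     #|V| = p ->
     regular F 2 ->
     (num_cycles F 3 <=
        num_cycles F 5 + \sum_(7 <= i < p.+1) num_cycles F i)%N ->
     OP_solvable F).
Proof.
split=> [|p Pp V F cV F2 hF]; first exact: OP_primes_infinite.
exact: OP_solvable_of_OP_prime Pp cV F2 hF.
Qed.
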